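(* Let $\mathcal{A}=\{1,2,\ldots,k\}$, let $p=(p_1,\ldots,p_k)$ be a probability vector with $p_1\ge p_2\ge\cdots\ge p_k>0$, and let $X=\mathcal{A}^\infty$ be equipped with the Bernoulli measure $m_p^\infty$. Then the Young partitions of $(X,m_p^\infty)$ have the following properties: (1) the increasing sequence of Young cylinder partitions $\bar\xi_n$, $n\ge1$, is total; (2) the decreasing sequence of Young tail partitions $\bar\eta_n$, $n\ge1$, is ergodic.
   Context: $m_p^\infty$ is the product measure on $\mathcal{A}^\infty$ under which coordinates are i.i.d. with $\mathrm{Prob}(i)=p_i$. For $x=(x_1,x_2,\ldots)\in X$ write $[x]_n=(x_1,\ldots,x_n)$. For a finite word $w$ in $\mathcal{A}$, $\mathrm{RSK}(w)=(P(w),Q(w))$ is the result of the Robinson–Schensted–Knuth algorithm with row insertion: letters are inserted successively, from left to right; inserting a letter $a$ into a row replaces (bumps) the leftmost entry strictly greater than $a$, the bumped entry being inserted into the next row, or appends $a$ to the end of the row if no entry is strictly greater than $a$. $P(w)$ is the resulting semistandard insertion tableau and $Q(w)$ is the standard recording tableau, of the same shape, denoted $\mathrm{sh}(w)$. The Young cylinder partition $\bar\xi_n$ and the Young tail partition $\bar\eta_n$ of $X$ are the partitions into classes of the equivalence relations $x\sim_{\bar\xi_n}y \iff Q([x]_n)=Q([y]_n)$, and $x\sim_{\bar\eta_n}y\iff \mathrm{sh}([x]_N)=\mathrm{sh}([y]_N)$ for all $N\ge n$. As usual for measurable partitions, everything is understood modulo sets of measure zero. An increasing sequence of measurable partitions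 is total if it converges weakly to the partition into separate points; that is, there is a set $X_0$ of full measure such that any two different points $x,y\in X_0$ lie in different elements of the $n$th partition for all sufficiently large $n$. A decreasing sequence of measurable partitions is ergodic if it converges weakly to the trivial partition (into a single set); that is, any measurable function which, for every $n$, coincides almost everywhere with a measurable function constant on the elements of the $n$th partition, is almost everywhere constant. *)

(* Defs.v *)
From HB Require Import structures.
From mathcomp Require Import all_boot all_order all_algebra.
From mathcomp Require Import all_classical all_reals all_analysis.

Set Implicit Arguments.
Unset Strict Implicit.
Unset Printing Implicit Defensive.

Import Order.TTheory GRing.Theory Num.Theory.

Local Open Scope classical_set_scope.
Local Open Scope ring_scope.

(* MathComp-Analysis.  The alphabet is 'I_k.+1, of arbitrary nonzero size k.+1,
   with letters numbered from 0, and the coordinate x_(i+1) of an infinite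
   word is x i. *)

(** ** Robinson-Schensted-Knuth row insertion *)

(* Tableaux are lists of rows, top row first.  The first component of the
   result is the bumped letter, if any. *)
Definition row_insert (k : nat) (a : 'I_k) (r : seq 'I_k) :
    option 'I_k * seq 'I_k :=
  let j := find (fun b : 'I_k => (a < b)%N) r in
  if (j < size r)%N then (Some (nth a r j), set_nth a r j a)
  else (None, rcons r a).

(* The second component of the result is the index of the row in which the
   shape gains a box. *)
Fixpoint tableau_insert (k : nat) (a : 'I_k) (t : seq (seq 'I_k)) :
    seq (seq 'I_k) * nat :=
  if t is r :: t' then
    match row_insert a r with
    | (None, r') => (r' :: t', 0%N)
    | (Some b, r') => let: (t'', i) := tableau_insert b t' in (r' :: t'', i.+1)
    end
  else ([:: [:: a]], 0%N).

(* When i = size t, this creates the new row [:: m]. *)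
Definition add_box (i m : nat) (t : seq (seq nat)) : seq (seq nat) :=
  set_nth [::] t i (rcons (nth [::] t i) m).

Definition rsk_step (k : nat) (PQ : seq (seq 'I_k) * seq (seq nat))
    (am : 'I_k * nat) : seq (seq 'I_k) * seq (seq nat) :=
  let: (P, i) := tableau_insert am.1 PQ.1 in (P, add_box i am.2 PQ.2).

Definition rsk (k : nat) (w : seq 'I_k) : seq (seq 'I_k) * seq (seq nat) :=
  foldl (@rsk_step k) ([::], [::]) (zip w (iota 1 (size w))).

Definition insertion_tableau (k : nat) (w : seq 'I_k) : seq (seq 'I_k) :=
  (rsk w).1.

Definition recording_tableau (k : nat) (w : seq 'I_k) : seq (seq nat) :=
  (rsk w).2.

Definition rsk_shape (k : nat) (w : seq 'I_k) : seq nat :=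
  shape (insertion_tableau w).

(** ** The Bernoulli space *)

HB.instance Definition _ (k : nat) := isPointed.Build 'I_k.+1 ord0.

Definition coordinate_sets (k : nat) : set (set (nat -> 'I_k.+1)) :=
  [set A | exists i a, A = [set x | x i = a]].

(* Infinite words with the product sigma-algebra. *)
Definition infinite_words (k : nat) := g_sigma_algebraType (@coordinate_sets k).

Definition initial_word (k : nat) (x : infinite_words k) (n : nat) :
    seq 'I_k.+1 := mkseq x n.

(* Cylinders form a pi-system generating the sigma-algebra, hence this
   determines mu: it is the law of i.i.d. letters of law p. *)
Definition is_bernoulli (R : realType) (k : nat) (p : 'I_k.+1 -> R)
    (mu : probability (infinite_words k) R) : Prop :=
  forall w : seq 'I_k.+1,
    mu [set x | initial_word x (size w) = w] = (\prod_(a <- w) p a)%:E.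

(** ** Measurable partitions modulo null sets *)

(* A partition is represented by the relation "to lie in the same element". *)

Definition full_measure d (T : measurableType d) (R : realType)
    (mu : probability T R) (X0 : set T) : Prop :=
  measurable X0 /\ mu X0 = 1%E.

(* Rokhlin's definition: up to a null set, the partition is the partition into
   the classes of points not separated by some countable family of measurable
   sets. *)
Definition measurable_partition d (T : measurableType d) (R : realType)
    (mu : probability T R) (r : T -> T -> Prop) : Prop :=
  exists B : nat -> set T, (forall i, measurable (B i)) /\
  exists2 X0, full_measure mu X0 &
    forall x y, X0 x -> X0 y -> (r x y <-> forall i, B i x <-> B i y).

Definition finer_partition d (T : measurableType d) (R : realType)
    (mu : probability T R) (r s : T -> T -> Prop) : Prop :=
  exists2 X0, full_measure mu X0 &
    forall x y, X0 x -> X0 y -> r x y -> s x y.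

(* Sequences of partitions are indexed by n >= 1; the value at 0 is ignored. *)

Definition increasing_partitions d (T : measurableType d) (R : realType)
    (mu : probability T R) (r : nat -> T -> T -> Prop) : Prop :=
  forall n, (1 <= n)%N ->
    measurable_partition mu (r n) /\ finer_partition mu (r n.+1) (r n).

Definition decreasing_partitions d (T : measurableType d) (R : realType)
    (mu : probability T R) (r : nat -> T -> T -> Prop) : Prop :=
  forall n, (1 <= n)%N ->
    measurable_partition mu (r n) /\ finer_partition mu (r n) (r n.+1).

Definition total_partitions d (T : measurableType d) (R : realType)
    (mu : probability T R) (r : nat -> T -> T -> Prop) : Prop :=
  exists2 X0, full_measure mu X0 &
    forall x y, X0 x -> X0 y -> x <> y ->
      exists m, forall n, (1 <= n)%N -> (m <= n)%N -> ~ r n x y.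

Definition ergodic_partitions d (T : measurableType d) (R : realType)
    (mu : probability T R) (r : nat -> T -> T -> Prop) : Prop :=
  forall f : T -> R, measurable_fun setT f ->
    (forall n, (1 <= n)%N ->
      exists g : T -> R, [/\ measurable_fun setT g,
        forall x y, r n x y -> g x = g y &
        {ae mu, forall x, f x = g x}]) ->
    exists c : R, {ae mu, forall x, f x = c}.

(** ** Young partitions *)

Definition young_cylinder (k n : nat) (x y : infinite_words k) : Prop :=
  recording_tableau (initial_word x n) = recording_tableau (initial_word y n).

Definition young_tail (k n : nat) (x y : infinite_words k) : Prop :=
  forall N, (n <= N)%N ->
    rsk_shape (initial_word x N) = rsk_shape (initial_word y N).

(* Main.v *)
(* Prepend a letter c to a word w.  The shape of c w is that of w plus one box,
   whose row r is at most c and can only move down when w is extended on the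
   right (Schuetzenberger's jeu-de-taquin path).  By stationarity the row
   lengths of an i.i.d. word are sums of such boxes, so their frequencies are
   the limit law of r; as p is nonincreasing, the frequency of row i is p_i.
   Hence r, which is at most c, has the same mean as c in the limit, and r = c
   almost surely as soon as w is long enough.

   Totality: a local growth rule shows that the shapes of all prefixes of
   x_1 x_2 ... determine those of x_2 x_3 ..., hence all rows r, hence almost
   surely all letters.

   Ergodicity: almost surely the shape of u w, for w a long prefix of the tail,
   is that of w plus the content of u; so permuting finitely many letters does
   not leave the class of the Young tail partition, and a function measurable
   with respect to all of them is exchangeable, hence constant by the
   Hewitt-Savage argument. *)

Require Import Defs.
From mathcomp Require Import all_boot all_order all_algebra.
From mathcomp Require Import all_classical all_reals all_analysis.
From mathcomp Require Import zify ring lra.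

Set Implicit Arguments.
Unset Strict Implicit.
Unset Printing Implicit Defensive.

Import Order.TTheory GRing.Theory Num.Theory.

Local Open Scope nat_scope.

(** Equal probabilities are allowed, so the deviation of the row lengths from [p i * n] cannot be
    expected to stay bounded; it only has to be o(n). The estimate has two halves.
    Deterministically, each row is a queue controlled by the largest deviation e of the letter
    counts over all prefixes, whence |row i - p_i n| <= C e. Probabilistically, second moments at a
    few times give a mean of e of order n^(3/4). On the other side, prepending c increases the sum
    of (entry - row) by c - r >= 0, and the probability of r < c decreases as the word gets longer.
    Hence n times this probability at length n, weighted by p_c, is at most the mean of that sum,
    which is O(n^(3/4)). The work is done on the numbers of small letters in the rows, where
    appending and prepending a letter are both local recursions over the levels; tableaux enter only
    through their shapes. *)

(** * Numbers of small letters in the rows of a tableau *)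

(* The number L j i of entries < j in row i of a tableau (rows and letters are
   numbered from 0) encodes the shape of its restriction to the letters < j,
   i.e. a row of its Gelfand-Tsetlin pattern.  Inserting the letter a adds, for
   each j > a, one box to this shape, in row box_row L a j: the box stays in the
   row of level j' = j - 1 unless the letter j' is bumped from there.  The value
   0 at j <= a is junk. *)
Fixpoint box_row (L : nat -> nat -> nat) (a j : nat) : nat :=
  if j is j'.+1 then
    if j' <= a then 0
    else box_row L a j' + (L j' (box_row L a j') < L j (box_row L a j'))
  else 0.

Definition level_step (L : nat -> nat -> nat) (a j i : nat) : nat :=
  L j i + ((a < j) && (i == box_row L a j)).

Definition levels (w : seq nat) : nat -> nat -> nat :=
  foldl level_step (fun _ _ => 0) w.

Definition interlacing (L : nat -> nat -> nat) : Prop :=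
  (forall i, L 0 i = 0) /\ forall j i, L j.+1 i.+1 <= L j i <= L j.+1 i.

Lemma box_rowS L a j : a < j ->
  box_row L a j.+1 =
  box_row L a j + (L j (box_row L a j) < L j.+1 (box_row L a j)).
Proof. by move=> aj; rewrite /= leqNgt aj. Qed.

Lemma box_row_start L a : box_row L a a.+1 = 0.
Proof. by rewrite /= leqnn. Qed.

(** The new box is an addable corner of level [j]. If it moves down from row [t], then
    [L j.+1 t.+1 <= L j t < L j.+1 t]; if it stays, then [L j.+1 t = L j t < L j t.-1 <= L j.+1
    t.-1]. *)
Lemma box_row_valid L a j : interlacing L -> a < j ->
  (box_row L a j < j) /\
  (0 < box_row L a j -> L j (box_row L a j) < L j (box_row L a j).-1).
Proof.
move=> [L0 LI]; elim: j => // j IH; rewrite ltnS leq_eqVlt.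
case/predU1P=> [<-|aj]; first by rewrite box_row_start.
rewrite box_rowS //; have [tj V] := IH aj.
set t := box_row L a j in tj V *.
move: (LI j t) (LI j t.-1).
have [->|t0] := posnP t; first by have [?|?] := ltnP (L j 0) (L j.+1 0);
  rewrite add0n /=; lia.
rewrite prednK //; have {}V := V t0.
by have [?|?] := ltnP (L j t) (L j.+1 t); rewrite ?addn1 ?addn0 /=; lia.
Qed.

Lemma level_step_interlacing L a : interlacing L -> interlacing (level_step L a).
Proof.
move=> LI; have V j := @box_row_valid L a j LI; case: LI => L0 LI; split.
  by move=> i; rewrite /level_step L0 ltn0.
move=> j i; rewrite /level_step; move: (V j) (LI j i) (LI j i.+1) => Vj.
case: (ltngtP j a) => [ja|aj|->]; last by rewrite ltnSn box_row_start; lia.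
  by rewrite [a < j.+1]ltnNge ja /=; lia.
rewrite ltnS (ltnW aj) box_rowS //=; have {Vj}[_] := Vj aj.
set t := box_row L a j => Vj.
have [?|h] := ltnP (L j t) (L j.+1 t); rewrite /= ?addn1 ?addn0.
  by rewrite eqSS; have [e|?] := eqVneq i t; [subst i; rewrite eqn_leq ltnn andbF|];
    lia.
case: (eqVneq i.+1 t) => [e|?]; last by lia.
by move: h Vj; rewrite -e eqn_leq ltnn andbF /=; lia.
Qed.

Lemma levels_rcons w a : levels (rcons w a) = level_step (levels w) a.
Proof. by rewrite /levels -cats1 foldl_cat. Qed.

Lemma levels_interlacing w : interlacing (levels w).
Proof.
by elim/last_ind: w => [|w a IH]; rewrite ?levels_rcons;
  [split|exact: level_step_interlacing].
Qed.

(** * Prepending a letter: the local growth rule *)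

(* Let mu and la be the numbers of letters < j and <= j, and let one letter < j
   be added to row r.  In column insertion a letter j displaced from row r bumps
   the letter j of the next column, and so on up to a column without letter j;
   the box added to la is therefore in the lowest row s <= r in which the strip
   of letters j can be extended. *)
Fixpoint strip_row (mu la : nat -> nat) (r : nat) : nat :=
  if r is r'.+1 then if la r < mu r' then r else strip_row mu la r' else 0.

(* Row of the box by which the levels j of w and c :: w differ, for j > c; the
   value c at j <= c stands for a fictitious box in the empty row c of level c,
   so that the recursion starts uniformly. *)
Fixpoint prefix_row (L : nat -> nat -> nat) (c j : nat) : nat :=
  if j is j'.+1 then
    if j' < c then c else strip_row (L j') (L j) (prefix_row L c j')
  else c.

(* Fomin's local rule: s and s' are the rows of the boxes by which the shapes of
   w, c :: w and of w a, c :: w a differ, and u and u' are the rows of the boxes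
   added by a to w and to c :: w. *)
Definition growth (la : nat -> nat) (s s' u u' : nat) : Prop :=
  (u != s /\ u' = u /\ s' = s) \/
  (u = s /\ u' = s' /\ (s' = s \/ (s' = s.+1 /\ la s.+1 = la s))).

Lemma strip_row_leq mu la r : strip_row mu la r <= r.
Proof. by elim: r => //= r IH; case: ltnP => // _; lia. Qed.

(** Row [s] has room for one more box of the strip, and all rows from [s.+1] to [r] are blocked by
    the row above. *)
Lemma strip_rowP mu la r s :
  reflect (s <= r /\ (0 < s -> la s < mu s.-1) /\
             forall i, s < i <= r -> mu i.-1 <= la i)
    (strip_row mu la r == s).
Proof.
apply: (iffP eqP) => [<-|].
  elim: r => [|r [IH1 [IH2 IH3]]] /=; first by do 2 split=> //; lia.
  case: ltnP => h; first by do 2 split=> //; lia.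
  split; first lia; split=> // i.
  rewrite [i <= _]leq_eqVlt => /andP[si /orP[/eqP->//|ir]]; apply: IH3; lia.
elim: r => [|r IH] /= [h1 [h2 h3]]; first lia.
case: ltnP => h.
  by have [//|e] := eqVneq r.+1 s; have := h3 r.+1; rewrite /= => /(_ _); lia.
have e : s != r.+1 by apply: contraTneq h => e; move: h2; rewrite e /=; lia.
by apply: IH; split; [lia|split=> // i hi; apply: h3; lia].
Qed.

(** Passage of the local rule from level [j] ([mu]) to level [j.+1] ([la]). Primes on [mu] and [la]
    refer to the word with a letter prepended, the index 2 to the word with a letter appended. Boxes
    that are apart at one level may meet at the next and conversely, so both alternatives of
    [growth] have to be carried along. *)
Lemma growth_strip mu la r r' t t' :
  let mu' i := mu i + (i == r) in
  let s := strip_row mu la r in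
  let la' i := la i + (i == s) in
  let rho := t + (mu t < la t) in
  let rho' := t' + (mu' t' < la' t') in
  let mu2 i := mu i + (i == t) in
  let la2 i := la i + (i == rho) in
  (forall i, la i.+1 <= mu i <= la i) ->
  (0 < t -> mu t < mu t.-1) ->
  (t = r -> 0 < t' -> mu' t' < mu' t'.-1) ->
  growth mu r r' t t' -> growth la s (strip_row mu2 la2 r') rho rho'.
Proof.
move=> mu' s la' rho rho' mu2 la2 LI Vt Vt' G.
have /strip_rowP[sr [C1 C2]] : strip_row mu la r == s by [].
case: G => [[tr [et' er']]|[et [et' er']]].
  subst r' t'; have Et : mu' t = mu t by rewrite /mu' (negbTE tr) addn0.
  have [st|st] := eqVneq s t.
    (* The prepended word has an additional box in row [t] at level [j.+1] but not at level [j], so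
       a letter [j] is there to be bumped. *)
    have Er' : rho' = t.+1.
      by rewrite /rho' Et /la' st eqxx; move: (LI t); lia.
    have C3 := C2 t.+1; rewrite /= in C3.
    have [q|q] := ltnP (mu t) (la t).
      left; rewrite Er' /rho q; split; first lia; split; first lia.
      apply/eqP/strip_rowP; split=> //.
      rewrite /mu2 /la2 /rho q; split=> [s0|i ir]; first by move: (C1 s0); lia.
      by move: (C2 i ir) (LI i); lia.
    have Erho : rho = t by rewrite /rho ltnNge q addn0.
    right; rewrite Er' Erho; split; first lia.
    suff -> : strip_row mu2 la2 r = t.+1.
      by split=> //; right; rewrite st; split=> //; move: (LI t); lia.
    apply/eqP/strip_rowP; split; first lia.
    rewrite /mu2 /la2 Erho /=; split=> [_|i ir]; first by move: (LI t); lia.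
    by move: (C2 i); lia.
  have Er' : rho' = rho.
    by rewrite /rho' /rho Et /la' [t == s]eq_sym (negbTE st) addn0.
  suff E : strip_row mu2 la2 r = s.
    rewrite E Er'; have [e|ne] := eqVneq rho s; last by left.
    by right; rewrite e; do 2 split=> //; left.
  apply/eqP/strip_rowP; split=> //.
  rewrite /mu2 /la2 /rho; have [q|q] := ltnP (mu t) (la t).
    split=> [s0|i ir]; [move: (C1 s0) | move: (C2 i ir)]; lia.
  split=> [s0|i ir]; first by move: (C1 s0); lia.
  move: (C2 i ir) (C2 t) (LI t); lia.
subst t t'; have {}Vt' := Vt' erefl.
have [e|e] : r' = r \/ r' = r.+1 /\ mu r.+1 = mu r by [].
  subst r'; move: Vt'; rewrite /mu' eqxx => Vt'.
  have [es|ns] := eqVneq s r.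
    have Er' : rho' = rho by rewrite /rho' /rho /mu' /la' -es eqxx; lia.
    have E : strip_row mu2 la2 r = r.
      apply/eqP/strip_rowP; split=> //; split; last lia.
      move=> r0; rewrite /mu2 /la2; move: (Vt' r0) (LI r) C1; rewrite es /rho.
      have -> : r.-1 == r = false by lia.
      by have [q|q] := ltnP (mu r) (la r); lia.
    rewrite E Er' es /growth; have [->|] := eqVneq rho r; last by left.
    by right; do 2 split => //; left.
  have r0 : 0 < r by lia.
  (* Since [s < r], row [r] of the strip is blocked, [mu r.-1 <= la r], while [r] is an addable
     corner of [mu]. *)
  have q : mu r < la r by move: (C2 r) (Vt r0); lia.
  have Erho : rho = r.+1 by rewrite /rho q addn1.
  left; split; first lia; split.
    rewrite Erho /rho' /mu' /la' eqxx; move: (C2 r) (Vt' r0).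
    have -> : r.-1 == r = false by lia.
    lia.
  apply/eqP/strip_rowP; split=> //; rewrite /mu2 /la2 Erho.
  by split=> [s0|i ir]; [move: (C1 s0)|move: (C2 i ir)]; lia.
case: e => {}er' em; subst r'.
(* As [mu r.+1 = mu r], interlacing forces [la r.+1 = mu r.+1]: row [r.+1] contains no letter [j] to
   bump. *)
have Er' : rho' = r.+1.
  rewrite /rho' /mu' /la'.
  have -> : r.+1 == r = false by lia.
  have -> : r.+1 == s = false by lia.
  by move: (LI r) (LI r.+1); lia.
have [q|q] := ltnP (mu r) (la r).
  have Erho : rho = r.+1 by rewrite /rho q addn1.
  left; rewrite Er' Erho; split; first lia; split=> //.
  apply/eqP/strip_rowP; split; first lia; rewrite /mu2 /la2 Erho.
  split=> [s0|i ir]; first by move: (C1 s0); lia.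
  have [->|ne] := eqVneq i r.+1; first by move: (LI r.+1) => /=; lia.
  by move: (C2 i); lia.
have Erho : rho = r by rewrite /rho ltnNge q addn0.
have es : s = r by apply/eqP/strip_rowP; split=> //; split=> [r0|]; [move: (LI r)
  (Vt r0)|]; lia.
right; rewrite Er' Erho es; split=> //.
suff -> : strip_row mu2 la2 r.+1 = r.+1.
  by split=> //; right; split=> //; move: (LI r) (LI r.+1); lia.
apply/eqP/strip_rowP; split=> //; split; last lia.
by move=> _; rewrite /mu2 /la2 Erho /=; move: (LI r); lia.
Qed.

Lemma prefix_rowS L c j : c <= j ->
  prefix_row L c j.+1 = strip_row (L j) (L j.+1) (prefix_row L c j).
Proof. by move=> cj; rewrite /= ltnNge cj. Qed.

Lemma prefix_row_start L c j : j <= c -> prefix_row L c j = c.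
Proof. by case: j => //= j ->. Qed.

Lemma prefix_row_leq L c j : prefix_row L c j <= c.
Proof.
elim: j => //= j IH; case: ifP => // _.
exact: leq_trans (strip_row_leq _ _ _) IH.
Qed.

(** Row 0 of [la] is never read, so a letter newly appended in row 0 does not affect [strip_row]. *)
Lemma eq_strip_row mu la mu' la' r :
  mu =1 mu' -> (forall i, la i.+1 = la' i.+1) ->
  strip_row mu la r = strip_row mu' la' r.
Proof. by move=> e f; elim: r => //= r ->; rewrite e f. Qed.

Lemma eq_box_row L L' a j : L =2 L' -> box_row L a j = box_row L' a j.
Proof. by move=> e; elim: j => //= j ->; rewrite !e. Qed.

Lemma prefix_row_growth L c a :
  interlacing L ->
  let L1 := level_step L a in
  let L' j i := L j i + ((c < j) && (i == prefix_row L c j)) in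
  interlacing L' ->
  forall j, c <= j ->
  if a < j then growth (L j) (prefix_row L c j) (prefix_row L1 c j)
                  (box_row L a j) (box_row L' a j)
  else prefix_row L1 c j = prefix_row L c j.
Proof.
move=> LI L1 L' LI'.
have low j : j <= c -> box_row L' a j = box_row L a j.
  elim: j => // j IH jc /=; rewrite IH; last exact: ltnW.
  by rewrite /L' !(ltnNge c) jc (ltnW jc) /= !addn0.
elim=> [|j IH] cj; first by move: cj; rewrite leqn0 => /eqP ->.
have [jc|{}cj] := leqP j.+1 c.
  have e : j.+1 = c by lia.
  (* At level [c] the fictitious box lies below all the rows in which [a] can add a box, so the two
     boxes are apart. *)
  rewrite !prefix_row_start //; case: ltnP => // aj; rewrite low //.
  by left; have [] := box_row_valid LI aj; rewrite e; lia.
have {}IH := IH cj; rewrite !prefix_rowS //.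
case: (ltngtP a j) IH => [aj|ja|ja] IH; rewrite ltnS.
- rewrite (ltnW aj) 2?box_rowS //.
  have [tj Vt] := box_row_valid LI aj; have [tj' Vt'] := box_row_valid LI' aj.
  have e0 : c = j -> box_row L' a j = box_row L a j /\ prefix_row L c j = j.
    by move=> e; rewrite low e // prefix_row_start.
  have e1 i : c < j -> L j i + (i == prefix_row L c j) = L' j i.
    by move=> e; rewrite /L' e.
  have e2 : L j (box_row L' a j) + (box_row L' a j == prefix_row L c j)
            = L' j (box_row L' a j).
    have [/e1 -> //|e] : c < j \/ c = j by lia.
    by have [-> ->] := e0 e; rewrite /L'; lia.
  have := growth_strip (fun i => proj2 LI j i) Vt _ IH.
  rewrite {}e2 -prefix_rowS // => G.
  have {}G := G _; have -> : L' j.+1 (box_row L' a j) =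
    L j.+1 (box_row L' a j) + (box_row L' a j == prefix_row L c j.+1).
    by rewrite /L' cj.
  have -> : strip_row (L1 j) (L1 j.+1) (prefix_row L1 c j) =
    strip_row (fun i => L j i + (i == box_row L a j))
     (fun i => L j.+1 i + (i == box_row L a j + (L j (box_row L a j)
       < L j.+1 (box_row L a j))))
     (prefix_row L1 c j).
    by apply: eq_strip_row => i; rewrite /L1 /level_step ?aj // box_rowS // ltnS ltnW.
  apply: G => et.
  have [/e1 e|/e0] : c < j \/ c = j by lia.
    by rewrite e.
  by move: et; lia.
- rewrite leqNgt ja /= IH; apply: eq_strip_row => i; rewrite /L1 /level_step.
    by rewrite [a < j]ltnNge (ltnW ja) addn0.
  by rewrite ltnS leqNgt ja addn0.
(* At level [a.+1] the letter [a] enters in row 0 of both words, invisibly to [strip_row]; the boxes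
   meet exactly when the prepended one is also in row 0. *)
rewrite -ja in IH *; rewrite leqnn !box_row_start IH.
have -> : strip_row (L1 a) (L1 a.+1) (prefix_row L c a) =
          strip_row (L a) (L a.+1) (prefix_row L c a).
  by apply: eq_strip_row => i; rewrite /L1 /level_step ?ltnn ?addn0 // ltnSn
    box_row_start addn0.
set s := strip_row _ _ _; have [->|ne] := eqVneq s 0; last by left; lia.
by right; do 2 split => //; left.
Qed.

(** Induction on the right end of [w]: in both cases of [growth] the pairs {s, u'} and {u, s'}
    coincide as multisets, so prepending [c] and appending [a] commute. *)
Lemma levels_cons c w j i :
  levels (c :: w) j i =
  levels w j i + ((c < j) && (i == prefix_row (levels w) c j)).
Proof.
elim/last_ind: w j i => [|w a IH] j i.
  rewrite /levels /= /level_step; case: ltnP => //= cj; congr (_ + (i == _)).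
  have -> : box_row (fun _ _ => 0) c j = 0 by elim: {cj}j => //= j ->; case: leqP.
  (* On the empty word nothing holds the fictitious box of row [c], which rises to row 0 at the
     first level above [c]. *)
  elim: j cj => // j IH; rewrite ltnS => cj; rewrite prefix_rowS //.
  by elim: (prefix_row _ _ _).
pose L := levels w; rewrite -rcons_cons !levels_rcons {1}/level_step IH.
pose L' j i := L j i + ((c < j) && (i == prefix_row L c j)).
have eL : levels (c :: w) =2 L' by [].
have LI : interlacing L := levels_interlacing w.
have LI' : interlacing L'.
  have [h1 h2] := levels_interlacing (c :: w).
  by split=> [k|k l]; rewrite -!eL.
rewrite (eq_box_row _ _ eL) /level_step -!/L.
have [jc|cj] := leqP j c.
  have -> : box_row L' a j = box_row L a j.
    elim: j jc => // k IHk kc /=; rewrite IHk; last exact: ltnW.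
    by rewrite /L' !(ltnNge c) kc (ltnW kc) /= !addn0.
  by rewrite /= !addn0.
have := prefix_row_growth a LI LI' (ltnW cj).
rewrite /= -/(level_step L a); set r1 := prefix_row (level_step L a) c j.
rewrite -/r1; case: (ltnP a j) => aj /=; last by move=> ->; rewrite !addn0.
rewrite /L'; case=> [[ne [-> ->]]|[-> [-> _]]]; lia.
Qed.
Lemma interlacing_noninc L j i i' : interlacing L -> i <= i' -> L j i' <= L j i.
Proof.
move=> [L0 LI] /subnK <-; elim: (i' - i) => // d; apply: leq_trans; rewrite addSn.
case: j => [|j]; first by rewrite !L0.
by move: (LI j (d + i)) => /andP[h1 h2]; exact: leq_trans h2.
Qed.

Lemma prefix_row_rcons K w c a : c < K -> a < K ->
  growth (levels w K) (prefix_row (levels w) c K)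
    (prefix_row (levels (rcons w a)) c K)
    (box_row (levels w) a K) (box_row (levels (c :: w)) a K).
Proof.
move=> cK aK; have eL := @levels_cons c w.
have LI' := levels_interlacing (c :: w).
have := @prefix_row_growth (levels w) c a (levels_interlacing w) _ K (ltnW cK).
rewrite aK levels_rcons (eq_box_row _ _ eL); apply.
by case: LI' => h1 h2; split=> [i|j i]; rewrite -!eL.
Qed.

Lemma prefix_row_rcons_leq K w c a : c < K -> a < K ->
  prefix_row (levels w) c K <= prefix_row (levels (rcons w a)) c K.
Proof. by move=> cK aK; case: (@prefix_row_rcons K w c a cK aK); lia. Qed.

(** The only ambiguity in going back is between [u = s] pushed down to [s.+1] and [u = s.+1] left in
    place. The former requires [la s.+1 = la s], and then [s.+1] is not an addable corner. *)
Lemma growth_inj la s s1 s2 u v u' :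
  (0 < u -> la u < la u.-1) -> (0 < v -> la v < la v.-1) ->
  growth la s s1 u u' -> growth la s s2 v u' -> u = v.
Proof.
move=> Vu Vv; case=> [[h1 [h2 h3]]|[h1 [h2 h3]]] [[g1 [g2 g3]]|[g1 [g2 g3]]]; try lia.
  case: g3 => [e|[e g4]]; first by lia.
  have eu : u = s.+1 by lia.
  by rewrite eu in Vu; move: (Vu isT); rewrite /=; lia.
case: h3 => [e|[e h4]]; first by lia.
have ev : v = s.+1 by lia.
by rewrite ev in Vv; move: (Vv isT); rewrite /=; lia.
Qed.

Lemma eq_indicator (f : nat -> nat) r s :
  (forall i, f i + (i == r) = f i + (i == s)) -> r = s.
Proof. by move=> /(_ r); rewrite eqxx; case: eqP => //; lia. Qed.

(* The growth rule can be run backwards: the shapes of all prefixes of c :: w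
   determine those of w. *)
Lemma levels_behead K (x y : nat -> nat) n :
  (forall i, x i < K) -> (forall i, y i < K) ->
  (forall m, m <= n.+1 -> levels (mkseq x m) K =1 levels (mkseq y m) K) ->
  levels (mkseq (x \o succn) n) K =1 levels (mkseq (y \o succn) n) K.
Proof.
move=> xK yK; elim: n => // n IH sh.
have {}IH := IH (fun m h => sh m (leqW h)).
have mkseq1 (z : nat -> nat) m : mkseq z m.+1 = z 0 :: mkseq (z \o succn) m.
  by rewrite /mkseq /= (iotaDl 1 0) -map_comp.
have mkseqr (z : nat -> nat) : mkseq (z \o succn) n.+1 =
  rcons (mkseq (z \o succn) n) (z n.+1) by rewrite mkseqS.
pose u := mkseq (x \o succn) n; pose v := mkseq (y \o succn) n.
have eux : mkseq x n.+1 = x 0 :: u by exact: mkseq1.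
have evy : mkseq y n.+1 = y 0 :: v by exact: mkseq1.
(* The known shapes give the boxes of the prepended letters ([er]) and of the letters appended to
   the long words ([eb]); [growth_inj] then recovers the boxes appended to [u] and [v]. *)
have er : prefix_row (levels u) (x 0) K = prefix_row (levels v) (y 0) K.
  apply: (@eq_indicator (levels u K)) => i.
  have := sh n.+1 (leqnSn _) i; rewrite eux evy !levels_cons xK yK /= -/u -/v.
  by rewrite IH.
have eb : box_row (levels (x 0 :: u)) (x n.+1) K = box_row (levels (y 0 :: v))
  (y n.+1) K.
  apply: (@eq_indicator (levels (x 0 :: u) K)) => i.
  have := sh n.+2 (leqnn _) i; rewrite !(mkseqS _ n.+1)
    eux evy !levels_rcons /level_step xK yK /=.
  by have := sh n.+1 (leqnSn _) i; rewrite eux evy => ->.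
have V w a : a < K -> 0 < box_row (levels w) a K ->
    levels w K (box_row (levels w) a K) < levels w K (box_row (levels w) a K).-1.
  by move=> aK; case: (box_row_valid (levels_interlacing w) aK).
have G1 := @prefix_row_rcons K u _ _ (xK 0) (xK n.+1).
have G2 := @prefix_row_rcons K v _ _ (yK 0) (yK n.+1).
rewrite -er -eb in G2.
have V2 := V v _ (yK n.+1); rewrite -!IH -/u in V2.
have G2' : growth (levels u K) (prefix_row (levels u) (x 0) K)
     (prefix_row (levels (rcons v (y n.+1))) (y 0) K)
     (box_row (levels v) (y n.+1) K) (box_row (levels (x 0 :: u)) (x n.+1) K).
  by move: G2; rewrite /growth -!IH.
have e := growth_inj (V u _ (xK n.+1)) V2 G1 G2'.
by move=> i; rewrite !mkseqr !levels_rcons /level_step xK yK /= -/u -/v IH e.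
Qed.

(** * The shape of the insertion tableau *)

Definition row_sorted (k : nat) (r : seq 'I_k) : bool :=
  pairwise (fun b c : 'I_k => b <= c) r.

Definition tableau_levels (k : nat) (t : seq (seq 'I_k)) (j i : nat) : nat :=
  count (fun b : 'I_k => b < j) (nth [::] t i).

Lemma row_insert_none k (a : 'I_k) r r' : row_sorted r ->
  row_insert a r = (None, r') ->
  [/\ row_sorted r', r' = rcons r a & forall c, c \in r -> c <= a].
Proof.
rewrite /row_insert -has_find; case: ifP => // /negbT.
move=> /hasPn h rs [<-]; have {}h c : c \in r -> c <= a by move/h; rewrite -leqNgt.
by split=> //; rewrite /row_sorted pairwise_rcons (rs : pairwise _ _) andbT;
  apply/allP => c /h.
Qed.

Lemma row_insert_some k (a b : 'I_k) r r' : row_sorted r ->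
  row_insert a r = (Some b, r') ->
  [/\ row_sorted r', a < b, b \in r, forall c, c \in r -> c <= a \/ b <= c
     & perm_eq (b :: r') (a :: r)].
Proof.
rewrite /row_insert; set P := fun c : 'I_k => a < c; set n := find P r.
case: ltnP => // nr rs [eb <-].
have hr : has P r by rewrite has_find.
have er : r = take n r ++ b :: drop n.+1 r.
  by rewrite -eb -drop_nth // cat_take_drop.
have ab : a < b by rewrite -eb; exact: (nth_find a hr).
have ta c : c \in take n r -> c <= a.
  move=> /(nthP a)[m]; rewrite size_take_min leq_min => /andP[mn _] <-.
  by rewrite nth_take //; have /negbT := before_find a mn; rewrite -leqNgt.
have bd c : c \in drop n.+1 r -> b <= c.
  move: rs; rewrite /row_sorted {1}er pairwise_cat pairwise_cons.
  by case/and4P => _ _ /allP h _; exact: h.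
split=> //.
- move: rs; rewrite set_nthE nr /row_sorted {1}er !pairwise_cat !pairwise_cons.
  case/and4P => /allrelP h1 h2 h3 ->; rewrite h2 /= andbT; apply/andP; split.
    apply/allrelP => x y xt; rewrite inE => /predU1P[->|yd]; first exact: ta.
    exact: leq_trans (ta _ xt) (ltnW (leq_trans ab (bd _ yd))).
  by apply/allP => y /bd yd; exact: ltnW (leq_trans ab yd).
- by rewrite er mem_cat mem_head orbT.
- move=> c; rewrite er mem_cat inE => /or3P[/ta|/eqP->|/bd]; [left|right|right] => //.
- rewrite set_nthE nr [in X in perm_eq _ X]er.
  by apply/permP => p; rewrite /= !count_cat /= addnCA [in RHS]addnCA [p b + (p a +
    _)]addnCA.
Qed.

Lemma count_below_absent k (r : seq 'I_k) j :
  (forall c : 'I_k, c \in r -> c != j :> nat) ->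
  count (fun b : 'I_k => b < j) r = count (fun b : 'I_k => b < j.+1) r.
Proof. by move=> h; apply: eq_in_count => c /h; lia. Qed.

Lemma count_below_present k (r : seq 'I_k) (b : 'I_k) : b \in r ->
  count (fun c : 'I_k => c < b) r < count (fun c : 'I_k => c < b.+1) r.
Proof.
move=> br; have := count_predUI (fun c : 'I_k => c < b) (pred1 b) r.
rewrite [count (predI _ _) r](@eq_count _ _ pred0) ?count_pred0 ?addn0; last first.
  by move=> c /=; case: eqP => [->|]; rewrite ?ltnn ?andbF.
rewrite [count (predU _ _) r](@eq_count _ _ (fun c : 'I_k => c < b.+1)) => [->|c /=].
  by rewrite -[X in X < _]addn0 ltn_add2l -has_count; apply/hasP; exists b => /=.
by rewrite -val_eqE /=; lia.
Qed.

(** The row that gains a box is read off at level [k], which contains all letters. *)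
Lemma tableau_insert_levels k (a : 'I_k) t : all (@row_sorted k) t ->
  let: (t', i) := tableau_insert a t in
  [/\ all (@row_sorted k) t',
      forall j l, tableau_levels t' j l = level_step (tableau_levels t) a j l,
      i = box_row (tableau_levels t) a k
    & size t' = maxn i.+1 (size t)].
Proof.
elim: t a => [|r t IH] a /= => [_|/andP[rs ts]].
  have e j : box_row (tableau_levels (Nil (seq 'I_k))) a j = 0.
    by elim: j => //= j ->; rewrite /tableau_levels /= if_same.
  split=> //; rewrite /level_step ?e // => j [|l]; rewrite e /tableau_levels /= ?addn0.
  - by rewrite add0n andbT.
  - by rewrite !nth_nil add0n andbF.
case ei: (row_insert a r) => [[b|] r'].
  have [rs' ab br gap perm] := row_insert_some rs ei.
  have {IH} := IH b ts; case: tableau_insert => t' i [ts' Lt' ei' st'].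
  (* Row [r] has no letter strictly between [a] and [b]: the box stays in row 0 up to level [b], and
     from level [b.+1] on it is that of [b] in the tableau [t] one row below. *)
  have e j : box_row (tableau_levels (r :: t)) a j =
             if j <= b then 0 else (box_row (tableau_levels t) b j).+1.
    elim: j => // j IHj; have [ja|aj] := leqP j a.
      by rewrite /= ja (leq_ltn_trans ja ab).
    rewrite box_rowS // IHj; case: (ltngtP j b) => [jb|bj|jb].
    - rewrite add0n /tableau_levels /= count_below_absent ?ltnn // => c /gap; lia.
    - by rewrite box_rowS.
    - by rewrite add0n jb box_row_start /tableau_levels /= count_below_present.
  split=> /=; first by rewrite rs'.
  - move=> j [|l]; rewrite /level_step e /tableau_levels /=.
      move/permP: perm => /(_ (fun c : 'I_k => c < j)) /=.
      by case: (leqP j b) => /=; lia.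
    rewrite -/(tableau_levels t' j l) Lt' /level_step -/(tableau_levels t j l).
    case: (leqP j b) => jb /=; first by rewrite andbF.
    by rewrite (ltn_trans ab jb) eqSS.
  - by rewrite e leqNgt ltn_ord /= ei'.
  - by rewrite st'; lia.
have [rs' er' ra] := row_insert_none rs ei; rewrite er' in rs' *.
have e j : box_row (tableau_levels (r :: t)) a j = 0.
  elim: j => // j IHj; have [ja|aj] := leqP j a; first by rewrite /= ja.
  rewrite box_rowS // IHj add0n.
  by rewrite /tableau_levels /= count_below_absent ?ltnn // => c /ra; lia.
split=> /=; rewrite ?e ?rs' //=.
- move=> j [|l]; rewrite /level_step e /tableau_levels /= ?andbF ?addn0 //.
  by rewrite -cats1 count_cat /= addn0 andbT.
- by lia.
Qed.

Lemma rsk_rcons k (w : seq 'I_k) a :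
  rsk (rcons w a) = rsk_step (rsk w) (a, (size w).+1).
Proof.
rewrite /rsk size_rcons; set n := size w.
have -> : iota 1 n.+1 = iota 1 n ++ [:: n.+1] by rewrite -(addn1 n)
  iotaD /= add1n addn1.
by rewrite -[rcons w a]cats1 zip_cat ?size_iota // foldl_cat.
Qed.

Definition word_levels (k : nat) (w : seq 'I_k) : nat -> nat -> nat :=
  levels [seq val a | a <- w].

Lemma insertion_tableau_levels k (w : seq 'I_k) :
  all (@row_sorted k) (insertion_tableau w) /\
  tableau_levels (insertion_tableau w) =2 word_levels w.
Proof.
elim/last_ind: w => [|w a [rs L]].
  by split=> // j i; rewrite /tableau_levels /insertion_tableau /rsk /= nth_nil.
have := tableau_insert_levels a rs.
rewrite /insertion_tableau rsk_rcons /rsk_step /=.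
case: tableau_insert => t i /= [rs' L' _ _]; split=> // j l.
rewrite L' /word_levels map_rcons levels_rcons /level_step L.
by rewrite (eq_box_row _ _ L).
Qed.

Lemma word_levels_rcons k (w : seq 'I_k) a :
  word_levels (rcons w a) = level_step (word_levels w) a.
Proof. by rewrite /word_levels map_rcons levels_rcons. Qed.

Lemma insertion_row_size k (w : seq 'I_k) i :
  size (nth [::] (insertion_tableau w) i) = word_levels w k i.
Proof.
have [_ <-] := insertion_tableau_levels w.
by rewrite /tableau_levels (@eq_count _ _ predT) ?count_predT // => b; rewrite ltn_ord.
Qed.

Lemma insertion_size_rcons k (w : seq 'I_k) a :
  size (insertion_tableau (rcons w a)) =
  maxn (box_row (word_levels w) a k).+1 (size (insertion_tableau w)).
Proof.
have [rs L] := insertion_tableau_levels w.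
have := tableau_insert_levels a rs.
rewrite /insertion_tableau rsk_rcons /rsk_step /=.
by case: tableau_insert => t i /= [_ _ -> ->]; rewrite (eq_box_row _ _ L).
Qed.

(** An empty row would be invisible in the row lengths; without such rows, the row lengths determine
    the list [rsk_shape]. *)
Lemma insertion_tableau_full k (w : seq 'I_k) i :
  i < size (insertion_tableau w) -> 0 < word_levels w k i.
Proof.
elim/last_ind: w i => // w a IH i; rewrite insertion_size_rcons leq_max.
rewrite word_levels_rcons /level_step ltn_ord /=.
case/orP => [|/IH]; last by lia.
rewrite ltnS leq_eqVlt => /predU1P[->|]; first by rewrite eqxx addn1.
set t := box_row _ _ _ => it; have := box_row_valid _ (ltn_ord a).
move=> /(_ (word_levels w) (levels_interlacing _))[_]; rewrite -/t.
move=> /(_ (leq_ltn_trans (leq0n _) it)) h.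
have it1 : i <= t.-1 by lia.
by have := interlacing_noninc k (levels_interlacing (map val w)) it1;
  rewrite -/(word_levels w); lia.
Qed.

Lemma eq_rsk_shape k (w w' : seq 'I_k) :
  rsk_shape w = rsk_shape w' <-> word_levels w k =1 word_levels w' k.
Proof.
have E (v : seq 'I_k) i : nth 0 (rsk_shape v) i = word_levels v k i.
  by rewrite -insertion_row_size /rsk_shape nth_shape.
split=> [e i|e]; first by rewrite -!E e.
have le (v v' : seq 'I_k) : word_levels v k =1 word_levels v' k ->
    size (rsk_shape v) <= size (rsk_shape v').
  move=> {}e; rewrite leqNgt; apply/negP => h.
  have := @insertion_tableau_full k v (size (rsk_shape v')).
  rewrite -[size (insertion_tableau v)](size_map size) => /(_ h).
  by rewrite e -E nth_default.
apply: (@eq_from_nth _ 0) => [|i _]; last by rewrite !E e.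
by apply/eqP; rewrite eqn_leq !le // => i; rewrite e.
Qed.

Lemma nth_add_box i m t l :
  nth [::] (add_box i m t) l =
  if l == i then rcons (nth [::] t l) m else nth [::] t l.
Proof. by rewrite /add_box nth_set_nth /=; case: eqP => // ->. Qed.

Lemma recording_rcons k (w : seq 'I_k) a :
  recording_tableau (rcons w a) =
  add_box (box_row (word_levels w) a k) (size w).+1 (recording_tableau w).
Proof.
have [rs L] := insertion_tableau_levels w.
have := tableau_insert_levels a rs.
rewrite /recording_tableau rsk_rcons /rsk_step /= -/(insertion_tableau w).
by case: tableau_insert => t i /= [_ _ -> _]; rewrite (eq_box_row _ _ L).
Qed.

Lemma recording_row_size k (w : seq 'I_k) i :
  size (nth [::] (recording_tableau w) i) = word_levels w k i.
Proof.
elim/last_ind: w => [|w a IH]; first by rewrite nth_nil.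
rewrite recording_rcons nth_add_box word_levels_rcons /level_step ltn_ord -IH /=.
by case: eqP => _; rewrite ?size_rcons ?addn1 ?addn0.
Qed.

Lemma recording_size k (w : seq 'I_k) :
  size (recording_tableau w) = size (insertion_tableau w).
Proof.
elim/last_ind: w => // w a IH.
by rewrite recording_rcons insertion_size_rcons /add_box size_set_nth IH.
Qed.

Lemma recording_entries k (w : seq 'I_k) i m :
  m \in nth [::] (recording_tableau w) i -> m <= size w.
Proof.
elim/last_ind: w => [|w a IH]; first by rewrite nth_nil.
rewrite recording_rcons nth_add_box size_rcons; case: eqP => _ /=.
  by rewrite mem_rcons inE => /predU1P[->//|/IH]; exact: leqW.
by move/IH; exact: leqW.
Qed.

(** Each step records a number larger than all previous ones, so erasing the entries above [m]
    undoes the later insertions. Hence the recording tableau remembers the shapes of all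
    prefixes. *)
Lemma recording_take k (w : seq 'I_k) m i : m <= size w ->
  [seq l <- nth [::] (recording_tableau w) i | l <= m] =
  nth [::] (recording_tableau (take m w)) i.
Proof.
elim/last_ind: w => [|w a IH]; first by rewrite nth_nil.
rewrite size_rcons leq_eqVlt => /predU1P[->|mw].
  rewrite take_oversize ?size_rcons //; apply/all_filterP/allP => l.
  by move/recording_entries; rewrite size_rcons.
rewrite -cats1 takel_cat // -IH // cats1 recording_rcons nth_add_box.
by case: eqP => // _; rewrite filter_rcons leqNgt mw.
Qed.

Lemma recording_take_inj k (w w' : seq 'I_k) m :
  m <= size w -> m <= size w' ->
  recording_tableau w = recording_tableau w' ->
  recording_tableau (take m w) = recording_tableau (take m w').
Proof.
move=> mw mw' e.
have en i : nth [::] (recording_tableau (take m w)) i =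
            nth [::] (recording_tableau (take m w')) i.
  by rewrite -!recording_take // e.
apply: (@eq_from_nth _ [::]) => // ; rewrite !recording_size.
have : rsk_shape (take m w) = rsk_shape (take m w').
  by apply/eq_rsk_shape => i; rewrite -!recording_row_size en.
by rewrite /rsk_shape => /(congr1 size); rewrite !size_map.
Qed.

Lemma recording_shape k (w w' : seq 'I_k) :
  recording_tableau w = recording_tableau w' -> word_levels w k =1 word_levels w' k.
Proof. by move=> e i; rewrite -!recording_row_size e. Qed.

(** * Frequencies of letters and lengths of rows *)

Definition upper_rows (w : seq nat) (j i : nat) : nat :=
  \sum_(l < i) levels w j l.

Lemma sum_level_step L a j i :
  \sum_(l < i) level_step L a j l =
  \sum_(l < i) L j l + ((a < j) && (box_row L a j < i)).
Proof.
rewrite big_split /=; congr (_ + _); case: (a < j) => /=; last by rewrite big1.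
case: ltnP => ti; last by rewrite big1 // => l _; case: eqP => //; have := ltn_ord l;
  lia.
by rewrite (bigD1 (Ordinal ti)) //= eqxx big1 // => l; rewrite -val_eqE /= =>
  /negbTE ->.
Qed.

Lemma upper_rowsS w j i : upper_rows w j i.+1 = upper_rows w j i + levels w j i.
Proof. by rewrite /upper_rows big_ord_recr. Qed.

Lemma upper_rows_rcons w a j i :
  upper_rows (rcons w a) j i =
  upper_rows w j i + ((a < j) && (box_row (levels w) a j < i)).
Proof. by rewrite /upper_rows levels_rcons sum_level_step. Qed.

Lemma upper_rows_nil j i : upper_rows [::] j i = 0.
Proof. by rewrite /upper_rows big1. Qed.

Lemma upper_rows_all w j : upper_rows w j j = count (fun a => a < j) w.
Proof.
elim/last_ind: w => [|w a IH]; first by rewrite upper_rows_nil.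
rewrite upper_rows_rcons IH -cats1 count_cat /= addn0; congr (_ + _).
case: ltnP => // aj; have [-> _] := box_row_valid (levels_interlacing w) aj.
by [].
Qed.

(* Row i seen as a queue of letters j: arrivals are the letters j not kept in
   the rows above i, services are the letters < j added to row i.  The services
   wasted up to time m are, up to sign, the difference of the two sides below;
   a service is wasted only when the queue is empty. *)
Lemma last_empty_time w j i : exists2 m, m <= size w &
  levels (take m w) j.+1 i = levels (take m w) j i /\
  upper_rows w j.+1 i.+1 + (upper_rows (take m w) j i + count_mem j (take m w)) =
  upper_rows (take m w) j.+1 i.+1 + (upper_rows w j i + count_mem j w).
Proof.
elim/last_ind: w => [|w a [m mw [em IH]]]; first by exists 0.
pose L := levels w; have [L0 LI] : interlacing L := levels_interlacing w.
have [] := boolP [&& a < j, box_row L a j == i & box_row L a j.+1 == i].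
  (* A service is wasted here: the box stays in row [i] because no letter [j] is there, so the
     current time becomes the last empty time. *)
  case/and3P => aj /eqP tj; rewrite box_rowS // tj => /eqP tj1.
  exists (size (rcons w a)) => //; rewrite take_size; split; last by lia.
  rewrite levels_rcons /level_step aj ltnS ltnW // box_rowS // tj tj1.
  by move: (LI j i); rewrite -/L; lia.
move=> h; exists m; first by rewrite size_rcons leqW.
rewrite -cats1 takel_cat // cats1; split=> //.
rewrite !upper_rows_rcons -cats1 count_cat [count _ [:: a]]/= addn0 -/L.
case: (ltngtP a j) h => [aj|ja|aj] h; rewrite ltnS.
- rewrite (ltnW aj) box_rowS // -/L in h *.
  by move: h IH; rewrite !andTb; lia.
- by move: IH; rewrite leqNgt ja; lia.
- by rewrite aj leqnn box_row_start; move: IH; lia.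
Qed.

Local Open Scope ring_scope.

(** All prefixes are controlled at once, since the estimate is applied at the last empty time of a
    queue, which is not known in advance. *)
Definition frequencies_within (R : realFieldType) (K : nat) (p : nat -> R)
    (w : seq nat) (e : R) : Prop :=
  forall m a, (m <= size w)%N -> (a < K)%N ->
    `|(count_mem a (take m w))%:R - p a * m%:R| <= e.

Definition row_error (R : realFieldType) (p : nat -> R) (j i : nat) (w : seq nat) : R :=
  (levels w j i)%:R - p i * (size w)%:R.

Lemma frequencies_within_take (R : realFieldType) K (p : nat -> R) w e m :
  frequencies_within K p w e -> frequencies_within K p (take m w) e.
Proof.
move=> h m' a m'w aK; rewrite size_take_min leq_min in m'w.
by case/andP: m'w => m'm m'w; rewrite take_takel //; apply: h.
Qed.

Lemma ler_norm_sum_const (R : realFieldType) n (F : 'I_n -> R) c :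
  (forall i, `|F i| <= c) -> `|\sum_i F i| <= n%:R * c.
Proof.
move=> h; apply: le_trans (ler_norm_sum _ _ _) _.
apply: le_trans (ler_sum _ (fun i _ => h i)) _.
by rewrite sumr_const card_ord mulr_natl.
Qed.

(** Row [i] of level [j.+1] is at least row [i] of level [j]. It is not much more: since the queue
    was last empty, letters [j] have arrived at rate about [p j], and services at rate about [p i],
    which is no smaller. *)
Lemma levels_bigO (R : realFieldType) K (p : nat -> R) :
  (forall i j, (i <= j)%N -> (j < K)%N -> p j <= p i) ->
  forall j, (j <= K)%N -> exists2 C : R, 0 <= C & forall w e,
    frequencies_within K p w e ->
    forall i, (i < j)%N -> `|row_error p j i w| <= C * e.
Proof.
move=> p_noninc; elim=> [|j IHj] jK; first by exists 0.
have [C0 C0_ge0 H0] := IHj (ltnW jK).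
suff : forall i, (i <= j.+1)%N -> exists2 C : R, 0 <= C & forall w e,
    frequencies_within K p w e ->
    forall l, (l < i)%N -> `|row_error p j.+1 l w| <= C * e by apply.
elim=> [|i IHi] ij; first by exists 0.
have [C1 C1_ge0 H1] := IHi (ltnW ij); rewrite ltnS in ij.
(* [C1] serves the rows above [i]. For row [i], the letters [j] in the rows above cost
   [i * (C0 + C1)] and their total count costs 1, each both at the end and at the last empty time;
   [C0] is the error of level [j] at the latter time. *)
exists (C1 + (2 * i%:R * (C0 + C1) + C0 + 2)).
  by rewrite !addr_ge0 // !mulr_ge0 // addr_ge0.
move=> w e fw l; rewrite ltnS leq_eqVlt.
have e_ge0 : 0 <= e by apply: le_trans (fw 0%N j _ _) => //.
have pos : 0 <= i%:R * (C0 + C1) * e by rewrite !mulr_ge0 // addr_ge0.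
have C0e : 0 <= C0 * e by exact: mulr_ge0.
have C1e : 0 <= C1 * e by exact: mulr_ge0.
case/predU1P=> [{l}->|li]; last first.
  by apply: le_trans (H1 _ _ fw _ li) _; lra.
have above v : frequencies_within K p v e ->
    `|(upper_rows v j i)%:R - (upper_rows v j.+1 i)%:R| <= i%:R * (C0 + C1) * e.
  move=> fv; rewrite /upper_rows !natr_sum -sumrB -mulrA;
    apply: ler_norm_sum_const => l.
  have lj : (l < j)%N by exact: leq_trans (ltn_ord l) ij.
  have := ler_distD 0 (row_error p j l v) (row_error p j.+1 l v).
  rewrite subr0 sub0r normrN => h.
  have -> : (levels v j l)%:R - (levels v j.+1 l)%:R =
            row_error p j l v - row_error p j.+1 l v by rewrite /row_error; ring.
  by apply: le_trans h _; rewrite mulrDl lerD // ?H0 ?H1.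
have letters v : frequencies_within K p v e ->
    `|(count_mem j v)%:R - p j * (size v)%:R| <= e.
  by move=> fv; rewrite -{1}[v]take_size; apply: fv.
have := above _ fw; have := letters _ fw.
move: ij; rewrite leq_eqVlt => /predU1P[->|ij].
  (* Row [j] is the lowest possible row for letters [<= j], so it contains exactly those that the
     rows above do not. *)
  have := upper_rows_all w j.+1; rewrite upper_rowsS.
  have -> : count (fun a => (a < j.+1)%N) w = (upper_rows w j j + count_mem j w)%N.
    rewrite upper_rows_all addnC -count_predUI [X in (_ = _ + X)%N](@eq_count _ _
      pred0).
      by rewrite count_pred0 addn0; apply: eq_count => a /=; lia.
    by move=> a /=; lia.
  move=> /(congr1 (fun n => n%:R : R)); rewrite !natrD /row_error !ler_norml; lra.
have [m mw [em E]] := last_empty_time w j i; set v := take m w in em E.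
have sv : size v = m by rewrite size_takel.
have fv : frequencies_within K p v e by exact: frequencies_within_take.
have := above _ fv; have := letters _ fv; have := H0 _ _ fv _ ij.
have := H0 _ _ fw _ ij; have [_ /(_ j i)] := levels_interlacing w.
case/andP => _; rewrite -(ler_nat R) => lw.
move: E; rewrite !upper_rowsS em => /(congr1 (fun n => n%:R : R)); rewrite !natrD.
(* Monotonicity of [p] enters here: after time [m] the drift of the queue is not positive. *)
have pm : 0 <= (p i - p j) * ((size w)%:R - m%:R).
  by rewrite mulr_ge0 ?subr_ge0 ?ler_nat // p_noninc // ltnW.
rewrite /row_error sv !ler_norml; nra.
Qed.

(* The sum of (entry - row) over the insertion tableau. *)
Definition defect (R : realFieldType) (K : nat) (w : seq nat) : R :=
  \sum_(a <- w) a%:R - \sum_(i < K) i%:R * (levels w K i)%:R.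

Lemma sum_letters (R : realFieldType) K (w : seq nat) : all (fun a => a < K)%N w ->
  \sum_(a <- w) a%:R = \sum_(i < K) i%:R * (count_mem (val i) w)%:R :> R.
Proof.
elim: w => [|a w IH] /=; first by rewrite big_nil big1 // => i _; rewrite mulr0.
case/andP=> aK wK; rewrite big_cons IH //.
under [RHS]eq_bigr do rewrite natrD mulrDr.
rewrite big_split /=; congr (_ + _).
rewrite (bigD1 (Ordinal aK)) //= eqxx mulr1 big1 ?addr0 // => i.
by rewrite -val_eqE /= eq_sym => /negbTE ->; rewrite mulr0.
Qed.

Lemma defect_cons (R : realFieldType) K c (w : seq nat) : (c < K)%N ->
  defect R K (c :: w) = defect R K w + (c%:R - (prefix_row (levels w) c K)%:R).
Proof.
move=> cK; rewrite /defect big_cons; under [X in _ - X = _]eq_bigr do rewrite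
  levels_cons natrD mulrDr cK.
rewrite big_split /=; set r := prefix_row _ _ _.
have rK : (r < K)%N by exact: leq_ltn_trans (prefix_row_leq _ _ _) cK.
have -> : \sum_(i < K) i%:R * ((i : nat) == r)%:R = r%:R :> R.
  rewrite (bigD1 (Ordinal rK)) //= eqxx mulr1 big1 ?addr0 // => i.
  by rewrite -val_eqE /= => /negbTE ->; rewrite mulr0.
by ring.
Qed.

(** The letter [i] and the row [i] have the same main term [p i * size w], so only their errors [e]
    and [C * e] remain, with weights [i <= K]. *)
Lemma defect_bigO (R : realFieldType) K (p : nat -> R) :
  (forall i j, (i <= j)%N -> (j < K)%N -> p j <= p i) ->
  exists2 C : R, 0 <= C & forall w e, all (fun a => a < K)%N w ->
    frequencies_within K p w e -> defect R K w <= C * e.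
Proof.
move=> /(levels_bigO)/(_ _ (leqnn K))[C C_ge0 H].
exists (K%:R * (K%:R * (1 + C))); first by rewrite !mulr_ge0 // addr_ge0.
move=> w e wK fw; rewrite /defect (sum_letters _ wK) -sumrB -!mulrA.
apply: le_trans (ler_norm _) _; apply: ler_norm_sum_const => i.
rewrite -mulrBr normrM normr_nat ler_pM // ?ler_nat ?(ltnW (ltn_ord i)) //.
have := H _ _ fw _ (ltn_ord i).
have := fw (size w) _ (leqnn _) (ltn_ord i); rewrite take_size /row_error !ler_norml.
by lra.
Qed.

(** * Mean values over random words *)

(** Expectation over [n] independent letters of law [p], as an iterated finite sum;
    [bernoulli_event] connects it with the measure. *)
Fixpoint word_mean (R : realFieldType) (T : finType) (p : T -> R) (n : nat)
    (F : seq T -> R) : R :=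
  if n is n'.+1 then \sum_a p a * word_mean p n' (fun w => F (a :: w))
  else F [::].

Section WordMean.
Variables (R : realFieldType) (T : finType) (p : T -> R).
Hypothesis p_ge0 : forall a, 0 <= p a.
Hypothesis p_sum : \sum_a p a = 1.

Lemma eq_word_mean n F G : (forall w, size w = n -> F w = G w) ->
  word_mean p n F = word_mean p n G.
Proof.
elim: n F G => [|n IH] F G h /=; first exact: h.
by apply: eq_bigr => a _; congr (_ * _); apply: IH => w sw; apply: h; rewrite /= sw.
Qed.

Lemma ler_word_mean n F G : (forall w, size w = n -> F w <= G w) ->
  word_mean p n F <= word_mean p n G.
Proof.
elim: n F G => [|n IH] F G h /=; first exact: h.
apply: ler_sum => a _; apply: ler_wpM2l => //.
by apply: IH => w sw; apply: h; rewrite /= sw.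
Qed.

Lemma word_meanD n F G :
  word_mean p n (fun w => F w + G w) = word_mean p n F + word_mean p n G.
Proof.
elim: n F G => [|n IH] F G //=.
by rewrite -big_split; apply: eq_bigr => a _; rewrite IH mulrDr.
Qed.

Lemma word_meanZ n c F : word_mean p n (fun w => c * F w) = c * word_mean p n F.
Proof.
elim: n F => [|n IH] F //=.
by rewrite mulr_sumr; apply: eq_bigr => a _; rewrite IH mulrCA.
Qed.

Lemma word_mean_cst n c : word_mean p n (fun=> c) = c.
Proof.
elim: n => [|n IH] //=; under eq_bigr do rewrite IH.
by rewrite -mulr_suml p_sum mul1r.
Qed.

Lemma word_mean_sum n (I : Type) (r : seq I) (F : I -> seq T -> R) :
  word_mean p n (fun w => \sum_(i <- r) F i w) = \sum_(i <- r) word_mean p n (F i).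
Proof.
elim: r => [|i r IH].
  rewrite big_nil -[RHS](word_mean_cst n 0).
  by apply: eq_word_mean => w _; rewrite big_nil.
rewrite big_cons -IH -word_meanD.
by apply: eq_word_mean => w _; rewrite big_cons.
Qed.

Lemma word_mean_take m n F : (m <= n)%N ->
  word_mean p n (fun w => F (take m w)) = word_mean p m F.
Proof.
elim: n m F => [|n IH] [|m] F //= mn; last first.
  by apply: eq_bigr => a _; rewrite (IH m (fun w => F (a :: w))).
transitivity (word_mean p n.+1 (fun=> F [::])) => //.
exact: word_mean_cst.
Qed.

Lemma word_mean_drop m n F :
  word_mean p (m + n) (fun w => F (drop m w)) = word_mean p n F.
Proof.
elim: m => [|m IH]; first by apply: eq_word_mean => w _; rewrite drop0.
by rewrite addSn /= IH -mulr_suml p_sum mul1r.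
Qed.

Lemma word_mean_antitone F : (forall w a, F (rcons w a) <= F w) ->
  {homo word_mean p ^~ F : m n / (m <= n)%N >-> n <= m}.
Proof.
move=> h m n /subnK <-; elim: (n - m)%N => // d; apply: le_trans.
rewrite addSn; elim: {d m}(d + m)%N F h => [|{}n IH] F h.
  rewrite -[leRHS]mul1r -p_sum mulr_suml.
  by apply: ler_sum => a _; apply: ler_wpM2l => //; apply: (h [::]).
apply: ler_sum => a _; apply: ler_wpM2l => //.
by apply: IH => w b; rewrite -rcons_cons.
Qed.

Lemma word_mean_sum_letters n q : \sum_a p a * q a = 0 ->
  word_mean p n (fun w => \sum_(a <- w) q a) = 0.
Proof.
move=> q0; elim: n => [|n IH] /=; first by rewrite big_nil.
rewrite -[RHS]q0; apply: eq_bigr => a _; congr (_ * _).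
transitivity (word_mean p n (fun w => q a + \sum_(b <- w) q b)).
  by apply: eq_word_mean => w _; rewrite big_cons.
by rewrite word_meanD word_mean_cst IH addr0.
Qed.

(** Independence and centring remove the cross terms, so each letter adds at most 1 to the
    variance. *)
Lemma word_mean_sum_letters_sqr n q : \sum_a p a * q a = 0 ->
  (forall a, `|q a| <= 1) ->
  word_mean p n (fun w => (\sum_(a <- w) q a) ^+ 2) <= n%:R.
Proof.
move=> q0 q1; elim: n => [|n IH] /=; first by rewrite big_nil expr0n.
set S := fun w : seq T => \sum_(a <- w) q a.
have q2 a : q a ^+ 2 <= 1.
  by have := q1 a; rewrite ler_norml => /andP[? ?]; nra.
have step a : word_mean p n (fun w => S (a :: w) ^+ 2) <= 1 + n%:R.
  apply: (@le_trans _ _ (word_mean p n (fun w => 1 + 2 * q a * S w + S w ^+ 2))).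
    apply: ler_word_mean => w _; rewrite {1}/S big_cons -/(S w).
    by have := q2 a; rewrite sqrrD mulr_natl mulrnAl; lra.
  rewrite !word_meanD word_meanZ word_mean_cst word_mean_sum_letters // mulr0 addr0.
  by rewrite lerD2l; exact: IH.
apply: le_trans (_ : \sum_a p a * (1 + n%:R) <= _).
  by apply: ler_sum => a _; apply: ler_wpM2l => //; exact: step.
by rewrite -mulr_suml p_sum mul1r -natr1 addrC.
Qed.

End WordMean.

Lemma word_mean_cat (R : realFieldType) (T : finType) (p : T -> R) m n F :
  word_mean p (m + n) F = word_mean p m (fun u => word_mean p n (fun v => F (u ++ v))).
Proof.
elim: m F => [|m IH] F //=; apply: eq_bigr => a _; congr (_ * _).
by rewrite (IH (fun w => F (a :: w))).
Qed.

Lemma word_mean_rcons (R : realFieldType) (T : finType) (p : T -> R) n F :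
  word_mean p n.+1 F = \sum_a p a * word_mean p n (fun w => F (rcons w a)).
Proof.
elim: n F => [|n IH] F //.
transitivity (\sum_a p a * word_mean p n.+1 (fun w => F (a :: w))) => //.
under eq_bigr do rewrite IH mulr_sumr.
rewrite exchange_big /=; apply: eq_bigr => b _; rewrite mulr_sumr.
by apply: eq_bigr => a _; rewrite mulrCA.
Qed.

Lemma word_mean_rot1 (R : realFieldType) (T : finType) (p : T -> R) n F :
  word_mean p n (fun w => F (rot 1 w)) = word_mean p n F.
Proof.
case: n => [|n] //; rewrite [RHS]word_mean_rcons /=.
apply: eq_bigr => a _; congr (_ * _); apply: eq_word_mean => w _.
by rewrite rot1_cons.
Qed.

(** * The mean defect of a random word *)

Section Defect.
Variables (R : realFieldType) (K : nat) (p : 'I_K -> R).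
Hypothesis p_ge0 : forall a, 0 <= p a.
Hypothesis p_sum : \sum_a p a = 1.
Hypothesis p_noninc : forall i j : 'I_K, (i <= j)%N -> p j <= p i.

Notation nats w := [seq val a | a <- w].
Notation mean := (word_mean p).

Let dev (j : 'I_K) (w : seq 'I_K) : R := \sum_(a <- w) ((a == j)%:R - p j).

Let devE j w : dev j w = (count_mem j w)%:R - p j * (size w)%:R.
Proof.
rewrite /dev; elim: w => [|a w IH]; first by rewrite big_nil mulr0 subr0.
by rewrite big_cons IH /= natrD -natr1; ring.
Qed.

Let p_le1 j : p j <= 1.
Proof. by rewrite -p_sum (bigD1 j) //= lerDl sumr_ge0. Qed.

Let letter_dev_le1 j a : `|(a == j)%:R - p j| <= 1.
Proof.
by rewrite ler_norml; move: (p_le1 j) (p_ge0 j); case: (a == j) => /=; lra.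
Qed.

Let dev_cat j w w' : dev j (w ++ w') = dev j w + dev j w'.
Proof. by rewrite /dev big_cat. Qed.

Let dev_le_size j w : `|dev j w| <= (size w)%:R.
Proof.
rewrite /dev; elim: w => [|a w IH]; first by rewrite big_nil normr0.
rewrite big_cons; apply: le_trans (ler_normD _ _) _.
by rewrite /= -natr1 addrC lerD.
Qed.

(* Words of length h^4 are cut into h blocks of length h^3. *)
Let mean_dev j n h : (0 < h)%N -> (n <= h ^ 4)%N ->
  mean n (fun w => `|dev j w|) <= (h ^ 2)%:R.
Proof.
move=> h0 nh; have h2 : 0 < (h ^ 2)%:R :> R by rewrite ltr0n expn_gt0 h0.
have pq : \sum_a p a * ((a == j)%:R - p j) = 0.
  under eq_bigr do rewrite mulrBr.
  rewrite sumrB -mulr_suml p_sum mul1r (bigD1 j) //= eqxx mulr1 big1 ?addr0 ?subrr //.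
  by move=> a /negbTE ->; rewrite mulr0.
have var := word_mean_sum_letters_sqr p_ge0 p_sum n pq (letter_dev_le1 j).
(* AM-GM: 2 |S| <= h^2 + S^2 / h^2 *)
apply: (@le_trans _ _ (mean n (fun w => (h ^ 2)%:R / 2 + (2 * (h ^ 2)%:R)^-1 * dev j
  w ^+ 2))).
  apply: ler_word_mean => // w _; rewrite -[dev j w ^+ 2]real_normK ?num_real //.
  rewrite -subr_ge0; move: h2 `|_| => /[swap] x; move: (h ^ 2)%:R => y y0.
  have -> : y / 2 + (2 * y)^-1 * x ^+ 2 - x = (2 * y)^-1 * (y - x) ^+ 2.
    by field; exact: lt0r_neq0.
  by rewrite mulr_ge0 ?sqr_ge0 // invr_ge0 mulr_ge0 // ltW.
rewrite word_meanD word_mean_cst // word_meanZ.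
have : (2 * (h ^ 2)%:R)^-1 * mean n (fun w => dev j w ^+ 2) <= (h ^ 2)%:R / 2.
  rewrite mulrC ler_pdivrMr ?mulr_gt0 //; apply: le_trans var _.
  have -> : (h ^ 2)%:R / 2 * (2 * (h ^ 2)%:R) = (h ^ 4)%:R :> R.
    by rewrite !natrX; field.
  by rewrite ler_nat.
by move=> le; rewrite [leRHS]splitr lerD2l.
Qed.

Let freq (j : nat) : R := if insub j is Some i then p i else 0.

(** Bounds the deviations of all letters over all prefixes: the double sum controls the block ends,
    the first term what happens inside a block. Summing over so few times takes the place of a
    maximal inequality. *)
Let block_error (h : nat) (w : seq 'I_K) : R :=
  2 * (h ^ 3)%:R + \sum_(j < K) \sum_(q < h.+1) `|dev j (take (h ^ 3 * q) w)|.

Let frequencies_block h w : (0 < h)%N -> size w = (h ^ 4)%N ->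
  frequencies_within K freq (nats w) (block_error h w).
Proof.
move=> h0 sw m j; rewrite size_map sw => mh jK.
have -> : freq j = p (Ordinal jK) by rewrite /freq insubT.
have -> : count_mem j (take m (nats w)) = count_mem (Ordinal jK) (take m w).
  by rewrite -map_take count_map; apply: eq_count => a /=; rewrite -val_eqE.
have h3 : (0 < h ^ 3)%N by rewrite expn_gt0 h0.
set q := (m %/ h ^ 3)%N.
have qh : (q < h.+1)%N.
  rewrite ltn_divLR // mulSn (leq_ltn_trans mh) // expnS -[ltnLHS]add0n.
  by rewrite ltn_add2r.
have mE : m = (h ^ 3 * q + m %% h ^ 3)%N by rewrite mulnC -divn_eq.
have -> : (count_mem (Ordinal jK) (take m w))%:R - p (Ordinal jK) * m%:R =
          dev (Ordinal jK) (take m w) by rewrite devE size_takel ?sw.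
rewrite mE takeD dev_cat; apply: le_trans (ler_normD _ _) _.
rewrite addrC lerD //.
  apply: le_trans (dev_le_size _ _) _.
  rewrite -[2](natrD _ 1 1) -natrM ler_nat size_take_min.
  by apply: leq_trans (geq_minl _ _) _; rewrite mul2n -addnn ltnW // ltn_addl //
    ltn_mod.
rewrite (bigD1 (Ordinal jK)) //= (bigD1 (Ordinal qh)) //= -addrA lerDl addr_ge0 //.
  by apply: sumr_ge0.
by apply: sumr_ge0 => i _; apply: sumr_ge0.
Qed.

(** For each letter there are [h.+1 <= 2 * h] block ends, each of mean at most [h ^ 2]. The total is
    of order n^(3/4) for n = h^4. *)
Let mean_block_error h : (0 < h)%N ->
  mean (h ^ 4) (block_error h) <= (2 + 2 * K%:R) * (h ^ 3)%:R.
Proof.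
move=> h0; rewrite /block_error word_meanD word_mean_cst // word_mean_sum //.
rewrite [leRHS]mulrDl lerD2l; apply: le_trans (_ : \sum_(j < K) (2 * (h ^ 3)%:R)
  <= _); last first.
  by rewrite sumr_const card_ord -mulr_natl; lra.
apply: ler_sum => j _; rewrite word_mean_sum //.
apply: le_trans (_ : \sum_(q < h.+1) (h ^ 2)%:R <= _).
  apply: ler_sum => q _.
  have qh : (h ^ 3 * q <= h ^ 4)%N by rewrite [leqRHS]expnSr leq_mul // -ltnS.
  rewrite (word_mean_take p_sum (fun w => `|dev j w|)) //.
  exact: mean_dev.
rewrite sumr_const card_ord -[leLHS]mulr_natl -!natrM ler_nat.
by rewrite [in leqRHS]expnS mulnA leq_mul // ; lia.
Qed.

Definition unsettled (c : 'I_K) (w : seq 'I_K) : R :=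
  (prefix_row (levels (nats w)) c K < c)%N%:R.

Lemma unsettled_rcons c w a : unsettled c (rcons w a) <= unsettled c w.
Proof.
rewrite /unsettled map_rcons ler_nat.
have := prefix_row_rcons_leq (nats w) (ltn_ord c) (ltn_ord a) => /=.
by move: (prefix_row _ _ _) (prefix_row _ _ _) => r r'; lia.
Qed.

(** Build the word by prepending letters: an unsettled letter adds at least 1 to the defect, and by
    [unsettled_rcons] each of the [n] mean increments is at least the one at length [n]. *)
Let mean_defect n : n%:R * \sum_c p c * mean n (unsettled c) <=
  mean n (fun w => defect R K (nats w)).
Proof.
have step m : \sum_c p c * mean m (unsettled c) + mean m (fun w => defect R K (nats w))
   <= mean m.+1 (fun w => defect R K (nats w)).
  rewrite -[X in _ + X]mul1r -p_sum mulr_suml -big_split.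
  apply: ler_sum => c _; rewrite /= -mulrDr; apply: ler_wpM2l => //.
  rewrite -word_meanD; apply: ler_word_mean => // w _ /=.
  rewrite defect_cons // [leRHS]addrC lerD2r /unsettled.
  have rc := prefix_row_leq (levels (nats w)) c K.
  by rewrite -natrB // ler_nat; move: rc; case: ltnP => /=; lia.
suff H : forall m, (m <= n)%N -> m%:R * \sum_c p c * mean n (unsettled c) <=
    mean m (fun w => defect R K (nats w)) by exact: (H n (leqnn n)).
elim=> [|m IH] mn.
  rewrite mul0r /= /defect big_nil big1 ?subr0 // => i _.
  by rewrite /levels /= mulr0.
apply: le_trans (step m); rewrite -natr1 mulrDl mul1r addrC lerD ?IH ?(ltnW mn) //.
apply: ler_sum => c _; apply: ler_wpM2l => //.
by apply: (word_mean_antitone p_ge0 p_sum (unsettled_rcons c)); exact: ltnW.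
Qed.

Lemma mean_unsettled : exists2 C : R, 0 <= C & forall h c, (0 < h)%N ->
  p c * mean (h ^ 4) (unsettled c) * h%:R <= C.
Proof.
have fnon i j : (i <= j)%N -> (j < K)%N -> freq j <= freq i.
  move=> ij jK; have iK := leq_ltn_trans ij jK.
  by rewrite /freq !insubT; apply: p_noninc.
have [C C_ge0 H] := defect_bigO fnon.
exists (C * (2 + 2 * K%:R)); first by rewrite mulr_ge0 // addr_ge0 // mulr_ge0.
move=> h c h0; have h3 : 0 < (h ^ 3)%:R :> R by rewrite ltr0n expn_gt0 h0.
(* Multiplying by [h ^ 3] makes the length [h ^ 4] appear on the left and the mean block error on
   the right. *)
rewrite -(ler_pM2r h3) -[leLHS]mulrA -[h%:R * _]natrM -expnS -[leRHS]mulrA.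
apply: le_trans (_ : C * mean (h ^ 4) (block_error h) <= _); last first.
  by rewrite ler_wpM2l // mean_block_error.
apply: le_trans (_ : mean (h ^ 4) (fun w => defect R K (nats w)) <= _); last first.
  rewrite -word_meanZ; apply: ler_word_mean => // w sw.
  apply: H; last exact: frequencies_block.
  by apply/allP => _ /mapP[a _ ->]; exact: ltn_ord.
apply: le_trans (mean_defect _); rewrite mulrC ler_wpM2l //.
rewrite (bigD1 c) //= lerDl; apply: sumr_ge0 => a _; rewrite mulr_ge0 //.
rewrite -(word_mean_cst p_sum (h ^ 4) 0); apply: ler_word_mean => // w _.
Qed.

End Defect.

(** * Almost sure settling *)

Local Open Scope classical_set_scope.
Local Open Scope ring_scope.

Definition subword (T : Type) (x : nat -> T) (m n : nat) : seq T :=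
  mkseq (fun i => x (m + i)%N) n.

Lemma subwordS (T : Type) (x : nat -> T) m n :
  subword x m n.+1 = x m :: subword x m.+1 n.
Proof.
rewrite /subword /mkseq /= addn0 (iotaDl 1 0) -map_comp; congr (_ :: _).
by apply: eq_map => i /=; rewrite addnA addn1.
Qed.

Lemma subword_rcons (T : Type) (x : nat -> T) m n :
  subword x m n.+1 = rcons (subword x m n) (x (m + n)%N).
Proof. exact: mkseqS. Qed.

Lemma size_subword (T : Type) (x : nat -> T) m n : size (subword x m n) = n.
Proof. exact: size_mkseq. Qed.

Lemma subwordD (T : Type) (x : nat -> T) m n n' :
  subword x m (n + n') = subword x m n ++ subword x (m + n) n'.
Proof.
elim: n m => [|n IH] m; first by rewrite addn0.
by rewrite addSn !subwordS IH addSnnS.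
Qed.

Lemma take_initial_word k (x : infinite_words k) m n : (m <= n)%N ->
  take m (initial_word x n) = initial_word x m.
Proof.
move=> mn; rewrite -[initial_word x n]/(subword x 0 n) -(subnKC mn) subwordD.
by rewrite take_size_cat ?size_subword.
Qed.

Lemma drop_initial_word k (x : infinite_words k) m n :
  drop m (initial_word x (m + n)) = subword x m n.
Proof.
rewrite -[initial_word x _]/(subword x 0 (m + n)) subwordD.
by rewrite drop_size_cat ?size_subword.
Qed.

Lemma measurable_coordinate k i (a : 'I_k.+1) :
  measurable [set x : infinite_words k | x i = a].
Proof. by apply: sub_sigma_algebra; exists i, a. Qed.

Lemma measurable_subword k m n (P : set (seq 'I_k.+1)) :
  measurable [set x : infinite_words k | P (subword x m n)].
Proof.
elim: n P => [|n IH] P.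
  have [p0|np0] := pselect (P [::]).
    by rewrite (_ : [set _ | _] = setT) //; apply/seteqP; split.
  by rewrite (_ : [set _ | _] = set0) //; apply/seteqP; split.
rewrite (_ : [set _ | _] = \bigcup_(a in [set: 'I_k.+1])
    ([set x : infinite_words k | x (m + n)%N = a] `&`
     [set x : infinite_words k | P (rcons (subword x m n) a)])).
  apply: fin_bigcup_measurable => // a _; apply: measurableI.
    exact: measurable_coordinate.
  exact: (IH (fun w => P (rcons w a))).
apply/seteqP; split=> x /=; rewrite subword_rcons.
  by move=> Px; exists (x (m + n)%N).
by move=> [a _ [<-]].
Qed.

Section Bernoulli.
Variables (R : realType) (k : nat) (p : 'I_k.+1 -> R).
Variable mu : probability (infinite_words k) R.
Hypothesis p_sum : \sum_(i < k.+1) p i = 1.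
Hypothesis mu_bernoulli : is_bernoulli p mu.

(** The fixed prefix [u] is there for the induction, which moves letters of the block into the
    prefix until [is_bernoulli] applies. *)
Let measure_extension_words u n (P : pred (seq 'I_k.+1)) :
  mu [set x | initial_word x (size u) = u /\ P (subword x (size u) n)] =
  ((\prod_(a <- u) p a) * word_mean p n (fun w => (P w)%:R))%:E.
Proof.
elim: n u P => [|n IH] u P /=.
  case: (P _).
    rewrite mulr1 -mu_bernoulli; congr (mu _).
    by apply/seteqP; split=> x //= [].
  rewrite mulr0 (_ : [set _ | _] = set0) ?measure0 //.
  by apply/seteqP; split=> x //= [].
pose F a := [set x : infinite_words k | initial_word x (size (rcons u a)) = rcons u a /\
   P (a :: subword x (size (rcons u a)) n)].
rewrite (_ : [set _ | _] = \bigcup_(a in [set: 'I_k.+1]) F a).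
  rewrite measure_fin_bigcup; last 3 first.
  - exact: finite_finset.
  - apply/trivIsetP => a b _ _ /eqP ab; apply/seteqP; split=> x //=.
    rewrite /F /= !size_rcons => -[[e1 _] [e2 _]]; apply: ab.
    by have /rcons_inj[] : rcons u a = rcons u b by rewrite -e1 -e2.
  - move=> a _; apply: measurableI; first exact: (measurable_subword 0 _ [set rcons u
      a]).
    exact: (measurable_subword _ _ (fun w => P (a :: w))).
  rewrite (fsbigE (index_enum 'I_k.+1)) /= ?index_enum_uniq //; last first.
    by move=> a _; rewrite mem_index_enum.
  transitivity (\sum_(a : 'I_k.+1)
      ((\prod_(b <- rcons u a) p b) * word_mean p n (fun w => (P (a :: w))%:R))%:E)%E.
    apply: eq_big => [a|a _]; first by rewrite in_setT.
    by rewrite -IH.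
  rewrite sumEFin mulr_sumr; congr (_%:E); apply: eq_bigr => a _.
  by rewrite -cats1 big_cat big_seq1 /= mulrA.
apply/seteqP; split=> x /=.
  rewrite subwordS => -[e Px]; exists (x (size u)) => //.
  rewrite /F /= size_rcons; split=> //.
  by rewrite -[X in _ = rcons X _]e /initial_word mkseqS.
move=> [a _]; rewrite /F /= size_rcons => -[e Px].
have /rcons_inj[e1 e2] : rcons (initial_word x (size u)) (x (size u)) = rcons u a.
  by rewrite -e /initial_word -mkseqS.
by rewrite subwordS e2.
Qed.

Lemma bernoulli_event n (P : pred (seq 'I_k.+1)) :
  mu [set x | P (initial_word x n)] = (word_mean p n (fun w => (P w)%:R))%:E.
Proof.
rewrite -[word_mean _ _ _]mul1r -[X in X * _](big_nil 1%R *%R xpredT p).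
rewrite -measure_extension_words; congr (mu _).
by apply/seteqP; split=> x //= [].
Qed.

Lemma bernoulli_shifted_event m n (P : pred (seq 'I_k.+1)) :
  mu [set x | P (subword x m n)] = (word_mean p n (fun w => (P w)%:R))%:E.
Proof.
rewrite -(word_mean_drop p_sum m) -(bernoulli_event _ (fun w => P (drop m w))).
congr (mu _); apply/seteqP; split=> x; by rewrite /mkset drop_initial_word.
Qed.

End Bernoulli.

(* sh(c x_m x_(m+1) ...) is eventually sh(x_m x_(m+1) ...) plus the letter c. *)
Definition settled (k : nat) (x : infinite_words k) : Prop :=
  forall m (c : 'I_k.+1), exists n,
    prefix_row (word_levels (subword x m n)) c k.+1 = c.

Lemma settled_eventually k (x : infinite_words k) m (c : 'I_k.+1) : settled x ->
  exists n0, forall n, (n0 <= n)%N ->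
    prefix_row (word_levels (subword x m n)) c k.+1 = c.
Proof.
move=> /(_ m c)[n0 e0]; exists n0 => n /subnK <-; elim: (n - n0)%N => // d IH.
rewrite addSn subword_rcons /word_levels map_rcons.
apply/eqP; rewrite eqn_leq prefix_row_leq /= -[X in (X <= _)%N]IH.
by apply: prefix_row_rcons_leq => //; exact: ltn_ord.
Qed.

Lemma full_measure_ae d (T : measurableType d) (R : realType)
    (mu : probability T R) (A : set T) : full_measure mu A -> {ae mu, forall x, A x}.
Proof.
move=> [mA A1]; exists (~` A); split=> //; first exact: measurableC.
by rewrite probability_setC // A1 subee.
Qed.

Lemma word_levels_subword k (x : infinite_words k) m n i :
  word_levels (subword x m n.+1) k.+1 i =
  (word_levels (subword x m.+1 n) k.+1 i +
   (i == prefix_row (word_levels (subword x m.+1 n)) (x m) k.+1))%N.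
Proof. by rewrite subwordS /word_levels /= levels_cons ltn_ord. Qed.

Lemma young_cylinder_levels k n (x y : infinite_words k) m : (m <= n)%N ->
  young_cylinder n x y ->
  word_levels (subword x 0 m) k.+1 =1 word_levels (subword y 0 m) k.+1.
Proof.
move=> mn /(recording_take_inj (m := m)); rewrite !size_mkseq => /(_ mn mn).
by rewrite !take_initial_word //; exact: recording_shape.
Qed.

Lemma settled_separated k (x y : infinite_words k) : settled x -> settled y ->
  (forall n, word_levels (subword x 0 n) k.+1 =1 word_levels (subword y 0 n) k.+1) ->
  x = y.
Proof.
move=> sx sy; suff H : forall m,
  (forall n, word_levels (subword x m n) k.+1 =1 word_levels (subword y m n) k.+1) ->
  x m = y m /\
  (forall n, word_levels (subword x m.+1 n) k.+1 =1 word_levels (subword y m.+1 n)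
    k.+1).
  move=> H0; have {}H0 : forall m n, word_levels (subword x m n)
    k.+1 =1 word_levels (subword y m n) k.+1.
    by elim=> // m IH; case: (H _ IH).
  by apply: funext => m; case: (H m (H0 m)).
move=> m e.
have e' n : word_levels (subword x m.+1 n) k.+1 =1 word_levels (subword y m.+1 n) k.+1.
  have := @levels_behead k.+1 (fun i => x (m + i)%N) (fun i => y (m + i)%N) n.
  have tl (z : infinite_words k) j :
     mkseq ((fun i => z (m + i)%N : nat) \o succn) j = map val (subword z m.+1 j).
    by rewrite /subword -map_comp; apply: eq_map => i /=; rewrite addSnnS.
  have hd (z : infinite_words k) j :
     mkseq (fun i => z (m + i)%N : nat) j = map val (subword z m j).
    by rewrite /subword -map_comp.
  rewrite !tl => h; apply: h => [i|i|j _]; [exact: ltn_ord|exact: ltn_ord|].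
  by rewrite !hd; exact: e.
split=> //.
have [n1 h1] := settled_eventually m.+1 (x m) sx.
have [n2 h2] := settled_eventually m.+1 (y m) sy.
apply: val_inj => /=; set n := maxn n1 n2.
rewrite -(h1 n) ?leq_maxl // -(h2 n) ?leq_maxr //.
apply: (@eq_indicator (word_levels (subword x m.+1 n) k.+1)) => i.
by rewrite -word_levels_subword e word_levels_subword e'.
Qed.

Section Settled.
Variables (R : realType) (k : nat) (p : 'I_k.+1 -> R).
Variable mu : probability (infinite_words k) R.
Hypothesis p_sum : \sum_(i < k.+1) p i = 1.
Hypothesis p_noninc : forall i j : 'I_k.+1, (i <= j)%N -> p j <= p i.
Hypothesis p_last_gt0 : 0 < p ord_max.
Hypothesis mu_bernoulli : is_bernoulli p mu.

Let p_gt0 i : 0 < p i.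
Proof. by apply: lt_le_trans p_last_gt0 _; apply: p_noninc; exact: leq_ord. Qed.

Let unsettled_from m (c : 'I_k.+1) : set (infinite_words k) :=
  \bigcap_n [set x | prefix_row (word_levels (subword x m n)) c k.+1 < c]%N.

Let measurable_unsettled_from m c : measurable (unsettled_from m c).
Proof.
by apply: bigcapT_measurable => n; exact: (measurable_subword m n
  [set w | prefix_row (word_levels w) c k.+1 < c]%N).
Qed.

Let unsettled_from0 m c : mu (unsettled_from m c) = 0%E.
Proof.
have [C C_ge0 HC] := mean_unsettled (fun i => ltW (p_gt0 i)) p_sum p_noninc.
have fin : mu (unsettled_from m c) \is a fin_num by exact: fin_num_measure.
rewrite -(fineK fin); congr (_%:E); apply/eqP;
  rewrite eq_le fine_ge0 ?measure_ge0 // andbT.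
rewrite leNgt; apply/negP => r0; set r := fine _ in r0.
have pr0 : 0 < p c * r by rewrite mulr_gt0.
(* The probability of being unsettled after [h ^ 4] letters is at most [C / (p c * h)], which is
   below [r] for this [h]. *)
pose h := Num.bound (C / (p c * r)).
have Ch : C / (p c * r) < h%:R by rewrite archi_boundP // divr_ge0 // ltW.
have h0 : (0 < h)%N by rewrite -(ltr_nat R); apply: le_lt_trans Ch;
  rewrite divr_ge0 // ltW.
have : p c * r * h%:R <= C.
  apply: le_trans (HC h c h0); rewrite ler_wpM2r // ler_wpM2l ?(ltW (p_gt0 c)) //.
  rewrite -lee_fin fineK //.
  rewrite -(bernoulli_shifted_event p_sum mu_bernoulli m (h ^ 4)
    (fun w => prefix_row (word_levels w) c k.+1 < c)%N).
  apply: le_measure; rewrite ?inE //; last by move=> x; apply.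
  exact: (measurable_subword m _ [set w | prefix_row (word_levels w) c k.+1 < c]%N).
by rewrite leNgt -ltr_pdivrMl // mulrC Ch.
Qed.

Lemma settled_full_measure : full_measure mu (@settled k).
Proof.
(* [inord] lets a natural number run through the letters, so that the countable union of null sets
   applies. *)
pose B n := \bigcup_j unsettled_from n (inord j).
have mB n : measurable (B n) by exact: bigcupT_measurable.
have e : ~` (@settled k) = \bigcup_n B n.
  apply/seteqP; split=> x /=.
    move=> ns; apply: contrapT => h; apply: ns => m c; apply: contrapT => nc.
    apply: h; exists m => //; exists c => // n _ /=; rewrite inord_val.
    have := prefix_row_leq (word_levels (subword x m n)) c k.+1.
    by rewrite leq_eqVlt => /orP[/eqP e|//]; case: nc; exists n.
  move=> [m _ [c _ u]] s; have [n e] := s m (inord c).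
  by move: (u n I : (_ < inord c)%N); rewrite e ltnn.
have mS : measurable (\bigcup_n B n) by exact: bigcupT_measurable.
have m0 : mu (\bigcup_n B n) = 0%E.
  apply: measure_negligible => //; apply: negligible_bigcup => n.
  apply: negligible_bigcup => j; apply/negligibleP; last exact: unsettled_from0.
  exact: measurable_unsettled_from.
have eS : @settled k = ~` \bigcup_n B n by rewrite -e setCK.
rewrite eS; split; first exact: measurableC.
by rewrite probability_setC // m0 sube0.
Qed.

End Settled.

(** * Exchangeable events *)

Definition word_event (k n : nat) (P : pred (seq 'I_k.+1)) : set (infinite_words k) :=
  [set x | P (initial_word x n)].

Lemma measurable_word_event k n P : measurable (@word_event k n P).
Proof. exact: (measurable_subword 0 n P). Qed.

Definition word_events (k : nat) : set (set (infinite_words k)) :=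
  [set A | exists n P, A = word_event n P].

Lemma coordinate_sets_word_events k :
  @coordinate_sets k `<=` @word_events k.
Proof.
move=> _ [i [a ->]]; exists i.+1, (fun w => nth ord0 w i == a).
apply/seteqP; split=> x; rewrite /word_event /= nth_mkseq //; first by move->.
by move/eqP.
Qed.

(* The n-th iterate, for M = 2n, moves the first n coordinates onto an
   independent block, which is all that the Hewitt-Savage argument requires. *)
Definition cycle_coordinates (k M : nat) (x : infinite_words k) : infinite_words k :=
  fun i => if (i < M)%N then x i.+1 else if i == M then x 0%N else x i.

Lemma initial_word_cycle k M (x : infinite_words k) :
  initial_word (cycle_coordinates M x) M.+1 = rot 1 (initial_word x M.+1).
Proof.
rewrite -[initial_word x _]/(subword x 0 M.+1) subwordS rot1_cons.
rewrite /initial_word mkseqS {2}/cycle_coordinates ltnn eqxx; congr rcons.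
apply: (@eq_from_nth _ ord0); rewrite ?size_mkseq ?size_subword // => i iM.
by rewrite !nth_mkseq // /cycle_coordinates iM.
Qed.

Lemma subword_cycle k M (x : infinite_words k) m n : (M < m)%N ->
  subword (cycle_coordinates M x) m n = subword x m n.
Proof.
move=> Mm; apply: eq_map => i; rewrite /cycle_coordinates.
have -> : (m + i < M)%N = false by lia.
by have -> : (m + i == M)%N = false by lia.
Qed.

Lemma measurable_cycle k M : measurable_fun setT (@cycle_coordinates k M).
Proof.
apply: (@measurability _ _ _ (infinite_words k) _ _ (@coordinate_sets k) erefl).
move=> _ [_ [i [a ->]] <-]; rewrite setTI.
have [iM|iM] := ltnP i M.
  rewrite (_ : _ @^-1` _ = [set x : infinite_words k | x i.+1 = a]).
    exact: measurable_coordinate.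
  by apply/seteqP; split=> x; rewrite /cycle_coordinates /= iM.
have [eM|nM] := eqVneq i M.
  rewrite (_ : _ @^-1` _ = [set x : infinite_words k | x 0%N = a]).
    exact: measurable_coordinate.
  by apply/seteqP; split=> x; rewrite /cycle_coordinates /= eM ltnn eqxx.
rewrite (_ : _ @^-1` _ = [set x : infinite_words k | x i = a]).
  exact: measurable_coordinate.
by apply/seteqP; split=> x; rewrite /cycle_coordinates /= ltnNge iM (negbTE nM).
Qed.

Lemma iter_cycle k M (x : infinite_words k) j i : (i + j <= M)%N ->
  iter j (@cycle_coordinates k M) x i = x (i + j)%N.
Proof.
elim: j i => [|j IH] i h; first by rewrite addn0.
rewrite /= {1}/cycle_coordinates; have -> : (i < M)%N by lia.
by rewrite IH ?addSnnS //; lia.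
Qed.

Section Exchangeability.
Variables (R : realType) (k : nat) (p : 'I_k.+1 -> R).
Variable mu : probability (infinite_words k) R.
Hypothesis p_sum : \sum_(i < k.+1) p i = 1.
Hypothesis mu_bernoulli : is_bernoulli p mu.

Lemma measure_word_event n P :
  mu (word_event n P) = (word_mean p n (fun w => (P w)%:R))%:E.
Proof. exact: bernoulli_event. Qed.

Lemma cycle_word_event M n P : mu (@cycle_coordinates k M @^-1` word_event n P) =
  mu (word_event n P).
Proof.
(* On words of length [N > M] the map is a rotation of the first [M.+1] letters, which preserves
   [word_mean]. *)
pose N := maxn n M.+1; pose P' v := P (take n v).
have eP : word_event n P = word_event N P'.
  apply/seteqP; split=> x; by rewrite /word_event /P' /= take_initial_word // leq_maxl.
have ev x : initial_word (cycle_coordinates M x) N =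
    rot 1 (take M.+1 (initial_word x (M.+1 + (N - M.+1)))) ++
    drop M.+1 (initial_word x (M.+1 + (N - M.+1))).
  rewrite take_initial_word ?leq_addr // drop_initial_word -initial_word_cycle.
  rewrite -(subword_cycle x _ (ltnSn M)) -[initial_word _ M.+1]/(subword _ 0 M.+1).
  by rewrite -[X in subword _ X (N - _)]add0n -subwordD subnKC ?leq_maxr.
have e : @cycle_coordinates k M @^-1` word_event n P =
    word_event (M.+1 + (N - M.+1)) (fun v => P' (rot 1 (take M.+1 v) ++ drop M.+1 v)).
  by rewrite eP; apply: funext => x; rewrite /preimage /word_event /mkset ev.
rewrite e eP !measure_word_event; congr (_%:E).
have -> : N = (M.+1 + (N - M.+1))%N by rewrite subnKC // leq_maxr.
set m := (N - M.+1)%N; rewrite -/m addKn !word_mean_cat.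
rewrite -[RHS](word_mean_rot1 _ M.+1); apply: eq_word_mean => u su.
apply: eq_word_mean => v sv; rewrite take_size_cat // drop_size_cat //.
Qed.

Lemma cycle_measure M A : measurable A ->
  mu (@cycle_coordinates k M @^-1` A) = mu A.
Proof.
move=> mA.
rewrite -[LHS]/(pushforward mu (@cycle_coordinates k M) A).
pose nu : {measure set (infinite_words k) -> \bar R} :=
  measure_function_pushforward__canonical__measure_function_Measure mu
    (@measurable_cycle k M).
rewrite -[LHS]/(nu A).
have sub : @word_events k `<=` measurable.
  by move=> _ [n [P ->]]; exact: measurable_word_event.
apply: (@g_sigma_algebra_measure_unique _ _ _ _ sub (fun=> setT)) => //.
- by move=> _; exists 0%N, predT; apply/seteqP; split.
- by rewrite bigcup_const //; exists 0%N.
- move=> _ _ [n [P ->]] [m [Q ->]]; exists (maxn n m), (fun w => P (take n w)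
    && Q (take m w)).
  apply/seteqP; split=> x; rewrite /word_event /=;
    rewrite !take_initial_word ?leq_maxl ?leq_maxr //; first by case=> -> ->.
  by case/andP.
- by move=> _ [n [P ->]]; exact: cycle_word_event.
- by move=> _; have -> : nu setT = 1%E by [exact: (probability_setT mu)]; rewrite ltry.
move: A mA; apply: sub_smallest2r; last exact: coordinate_sets_word_events.
exact: smallest_sigma_algebra.
Qed.

End Exchangeability.

(** * Approximation by events on finitely many letters *)

Definition close_upto d (T : measurableType d) (R : realType)
    (mu : probability T R) (e : R) (A B : set T) : Prop :=
  exists N, [/\ measurable N, (mu N <= e%:E)%E & forall x, ~ N x -> (A x <-> B x)].

Section Approximation.
Variables (R : realType) (k : nat) (mu : probability (infinite_words k) R).

Let approximable : set (set (infinite_words k)) := [set A | measurable A /\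
  forall e : R, 0 < e -> exists n P, close_upto mu e A (word_event n P)].

Let approximable_setU A B : approximable A -> approximable B -> approximable (A `|` B).
Proof.
move=> [mA hA] [mB hB]; split; first exact: measurableU.
move=> e e0; have e2 : 0 < e / 2 by rewrite divr_gt0.
have [n [P [N [mN N_e HN]]]] := hA _ e2; have [m [Q [M [mM M_e HM]]]] := hB _ e2.
exists (maxn n m), (fun w => P (take n w) || Q (take m w)), (N `|` M); split.
- exact: measurableU.
- apply: le_trans (measureU2 _ mN mM) _.
  by rewrite [e in leRHS]splitr EFinD leeD.
- move=> x /not_orP[/HN hn /HM hm].
  rewrite /word_event /mkset !take_initial_word ?leq_maxl ?leq_maxr //.
  split; first by case=> [/hn ->|/hm ->] //; rewrite orbT.
  by case/orP => [/hn|/hm]; [left|right].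
Qed.

Let approximable_sigma_algebra : sigma_algebra setT approximable.
Proof.
split.
- split=> // e e0; exists 0%N, pred0, set0; split=> //;
    first by rewrite measure0 lee_fin ltW.
- move=> A [mA hA]; rewrite setTD; split; first exact: measurableC.
  move=> e e0; have [n [P [N [mN N_e HN]]]] := hA e e0.
  exists n, (fun w => ~~ P w), N; split=> // x /HN h.
  by rewrite /word_event /mkset; split=> [nA|/negP nP]; [apply/negP => /h|move=> /h].
move=> A hA; have mU : measurable (\bigcup_i A i) by apply: bigcupT_measurable => i;
  case: (hA i).
split=> // e e0; have e2 : 0 < e / 2 by rewrite divr_gt0.
(* The union is approximated up to [e / 2] by a finite one, because [mu] tends to 0 along the
   decreasing remainders [D n]; the other [e / 2] is for approximating the finite union. *)
pose F n := \bigcup_(i < n) A i.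
have hF n : approximable (F n).
  rewrite /F; elim: n => [|n IH]; first by rewrite bigcup0 => [|//]; split=> // e' e'0;
    exists 0%N, pred0, set0; split=> //; rewrite measure0 lee_fin ltW.
  by rewrite bigcup_mkord big_ord_recr /= -bigcup_mkord; exact: approximable_setU.
pose D n := (\bigcup_i A i) `\` F n.
have mD n : measurable (D n) by apply: measurableD => //; case: (hF n).
have D0 : \bigcap_n D n = set0.
  apply/seteqP; split=> // x h; have [[i _ Aix] _] := h 0%N I.
  by have [_] := h i.+1 I; apply; exists i => /=.
have : mu \o D @ \oo --> mu (\bigcap_n D n).
  apply: nonincreasing_cvg_mu => //; first by rewrite -ge0_fin_numE ?measure_ge0 //
    fin_num_measure.
    exact: bigcapT_measurable.
  move=> i j ij; apply/subsetPset => x [Ux nF]; split=> // -[l /= li Al].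
  by apply: nF; exists l => //=; exact: leq_trans ij.
rewrite D0 measure0 => /fine_cvgP[_ /cvgrPdist_le/(_ _ e2)[n _ /(_ n (leqnn _))]] /=.
rewrite sub0r normrN ger0_norm ?fine_ge0 ?measure_ge0 // => De.
have {}De : (mu (D n) <= (e / 2)%:E)%E.
  by rewrite -[mu (D n)]fineK ?fin_num_measure // lee_fin.
have [m [P [N [mN N_e HN]]]] := (hF n).2 _ e2.
exists m, P, (D n `|` N); split; first exact: measurableU.
- apply: le_trans (measureU2 _ (mD n) mN) _; by rewrite [e in leRHS]splitr EFinD leeD.
- move=> x /not_orP[nD /HN <-]; split=> [Ux|[i _ Ai]]; last by exists i.
  by apply: contrapT => nF; apply: nD.
Qed.

Lemma approximation A : measurable A -> forall e : R, 0 < e ->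
  exists n P, close_upto mu e A (word_event n P).
Proof.
move=> mA; suff : approximable A by case.
apply: (smallest_sub approximable_sigma_algebra) mA.
move=> _ [i [a ->]]; split; first exact: measurable_coordinate.
move=> e e0; have [n [P eP]] : word_events [set x : infinite_words k | x i = a].
  by apply: coordinate_sets_word_events; exists i, a.
by exists n, P, set0; split=> //; [rewrite measure0 lee_fin ltW|rewrite eP].
Qed.

End Approximation.

(** * The zero-one law for exchangeable events *)

Section ZeroOne.
Variables (R : realType) (k : nat) (p : 'I_k.+1 -> R).
Variable mu : probability (infinite_words k) R.
Hypothesis p_sum : \sum_(i < k.+1) p i = 1.
Hypothesis mu_bernoulli : is_bernoulli p mu.

Lemma ae_cycle M (Q : infinite_words k -> Prop) :
  {ae mu, forall x, Q x} -> {ae mu, forall x, Q (cycle_coordinates M x)}.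
Proof.
move=> [N [mN N0 sub]]; exists (@cycle_coordinates k M @^-1` N); split.
- by rewrite -[X in measurable X]setTI; exact: measurable_cycle.
- by rewrite (cycle_measure mu_bernoulli).
- by move=> x; exact: sub.
Qed.

Let iter_cycle_measure M j A : measurable A ->
  measurable (iter j (@cycle_coordinates k M) @^-1` A) /\
  mu (iter j (@cycle_coordinates k M) @^-1` A) = mu A.
Proof.
elim: j A => // j IH A mA.
have mB : measurable (@cycle_coordinates k M @^-1` A).
  by rewrite -[X in measurable X]setTI; exact: measurable_cycle.
have [mC eC] := IH _ mB; split; first exact: mC.
by rewrite -(cycle_measure mu_bernoulli M mA) -eC.
Qed.

Let event_product n P :
  mu (word_event n P `&` [set x | P (subword x n n)]) = (mu (word_event n P)
    * mu (word_event n P))%E.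
Proof.
have -> : word_event n P `&` [set x : infinite_words k | P (subword x n n)] =
   word_event (n + n) (fun w => P (take n w) && P (drop n w)).
  apply: funext => x; rewrite /word_event /setI /mkset take_initial_word ?leq_addr //.
  by rewrite drop_initial_word; apply/propext; split=> [[-> ->] //|/andP].
rewrite !(measure_word_event mu_bernoulli) -EFinM; congr (_%:E); rewrite word_mean_cat.
rewrite -word_meanZ; apply: eq_word_mean => u su.
rewrite mulrC -word_meanZ; apply: eq_word_mean => v sv.
by rewrite take_size_cat // drop_size_cat //; case: (P u); case: (P v);
  rewrite ?mulr1 ?mulr0.
Qed.

(** [A] is close to an event on the first [n] letters and, being invariant, also to the same event
    on the next [n] letters. These two are independent, so [mu A] is close to its own square. *)
Lemma exchangeable_zero_one A : measurable A ->
  (forall M, {ae mu, forall x, A (cycle_coordinates M x) <-> A x}) ->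
  mu A = 0%E \/ mu A = 1%E.
Proof.
move=> mA inv; set a := fine (mu A); have ea : mu A = a%:E by rewrite fineK //
  fin_num_measure.
have a0 : 0 <= a by rewrite fine_ge0.
have a1 : a <= 1 by rewrite -lee_fin -ea probability_le1.
(* With [b] the measure of the approximating event, [b <= a + e] and [a <= b * b + 2 * e]; as [a]
   and [e] are at most 1, (a + e)^2 + 2e <= a^2 + 5e. *)
suff H (e : R) : 0 < e -> e <= 1 -> a <= a ^+ 2 + 5 * e.
  have : a <= a ^+ 2.
    rewrite leNgt; apply/negP => h; pose e := Num.min 1 ((a - a ^+ 2) / 10).
    have h' : 0 < a - a ^+ 2 by rewrite subr_gt0.
    have e0 : 0 < e by rewrite lt_min ltr01 divr_gt0.
    have e1 : e <= 1 by rewrite ge_min lexx.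
    have e2 : e <= (a - a ^+ 2) / 10 by rewrite ge_min lexx orbT.
    by have := H e e0 e1; lra.
  rewrite ea => h; have [->|an0] := eqVneq a 0; [by left|right; congr (_%:E)].
  have ap : 0 < a by rewrite lt_neqAle eq_sym an0.
  by apply/eqP; rewrite eq_le a1 -(ler_pM2l ap) mulr1 -expr2.
move=> e0 e1; have [n [P [N [mN N_e HN]]]] := approximation mu mA e0.
pose phi := iter n (@cycle_coordinates k (n + n)).
have : {ae mu, forall x, A (phi x) <-> A x}.
  rewrite /phi; move: (n + n)%N => M; elim: n {HN phi} => [|j IH]; first by apply: aeW.
  have := ae_cycle M IH; apply: filterS2 (inv M) => x h1 h2; rewrite iterSr.
  exact: iff_trans h2 h1.
move=> [Z [mZ Z0 HZ]].
have [mN' eN'] := iter_cycle_measure (n + n) n mN.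
set N' := _ @^-1` _ in mN' eN'.
set B := word_event n P; set b := fine (mu B).
have mB : measurable B by exact: measurable_word_event.
have eb : mu B = b%:E by rewrite fineK // fin_num_measure.
have b0 : 0 <= b by rewrite fine_ge0.
have hb : b <= a + e.
  rewrite -lee_fin EFinD -ea -eb; apply: le_trans (leeD (lexx _) N_e).
  apply: le_trans (measureU2 mu mA mN); apply: le_measure; rewrite ?inE //.
    exact: measurableU.
  move=> x Bx; have [?|/HN h] := pselect (N x); [by right|left].
  by apply/h.
have phiE x : initial_word (phi x) n = subword x n n.
  apply: (@eq_from_nth _ ord0); rewrite size_mkseq ?size_subword // => i iN.
  by rewrite !nth_mkseq // /phi iter_cycle 1?addnC // leq_add2l ltnW.
have ha : a <= b * b + (e + e).
  rewrite -lee_fin !EFinD EFinM -ea -eb -event_product -/B.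
  have mB' : measurable (B `&` [set x | P (subword x n n)]).
    by apply: measurableI => //; exact: (measurable_subword n n P).
  have mNN : measurable (N `|` (N' `|` Z)) by do 2 apply: measurableU => //.
  apply: le_trans (_ : mu (B `&` [set x | P (subword x n n)]) + mu (N `|` (N' `|` Z))
    <= _)%E; last first.
    rewrite leeD2l //; apply: le_trans (measureU2 mu mN (measurableU _ _ mN' mZ)) _.
    rewrite leeD //; apply: le_trans (measureU2 mu mN' mZ) _.
    have hN' : (mu N' <= e%:E)%E by rewrite eN'.
    have hZ : (mu Z <= 0)%E by rewrite Z0.
    by rewrite -[leRHS]adde0; exact: leeD hN' hZ.
  apply: le_trans (measureU2 mu mB' mNN); apply: le_measure; rewrite ?inE //.
    exact: measurableU.
  (* Off the three exceptional sets, [x] and [phi x] both lie in [A] and are both well approximated,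
     so both blocks of [x] satisfy [P]. *)
  move=> x Ax; have [?|nN] := pselect ((N `|` (N' `|` Z)) x); [by right|left].
  move: nN => /not_orP[/HN h /not_orP[nN' nZ]]; split; first by apply/h.
  have Aphi : A (phi x) by apply: contrapT => nA; apply: nZ; apply: HZ => /=; tauto.
  by have /HN : ~ N (phi x) by []; rewrite /word_event /mkset phiE => <-.
have := ler_pM b0 b0 hb hb; nra.
Qed.

End ZeroOne.

(** The distribution function of [f] takes only the values 0 and 1, and [f] equals almost everywhere
    the point where it jumps. *)
Lemma zero_one_ae_const d (T : measurableType d) (R : realType)
    (mu : probability T R) (f : T -> R) : measurable_fun setT f ->
  (forall c, mu [set x | f x <= c] = 0%E \/ mu [set x | f x <= c] = 1%E) ->
  exists c, {ae mu, forall x, f x = c}.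
Proof.
move=> mf zo; pose L c := [set x | f x <= c].
have mL c : measurable (L c).
  rewrite (_ : L c = f @^-1` `]-oo, c]); last first.
    by apply/seteqP; split=> x; rewrite /L /= in_itv.
  by rewrite -[X in measurable X]setTI; exact: mf.
have L01 c : mu (L c) != 0%E -> mu (~` L c) = 0%E.
  move=> /eqP n0; have [//|L1] := zo c.
  by rewrite probability_setC // -/(L c) [mu _]L1 subee.
have LS c c' : c <= c' -> (mu (L c) <= mu (L c'))%E.
  by move=> cc; apply: le_measure; rewrite ?inE // => x h; exact: le_trans h cc.
(* Null sets cannot cover the space: applied to the sets [f > -n] and [f <= n], this makes [S]
   nonempty and bounded above, so that its supremum is the jump. *)
have nonnull (F : nat -> set T) : (forall n, measurable (F n)) ->
    \bigcup_n F n = setT -> exists n, mu (F n) != 0%E.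
  move=> mF cover; apply: contrapT => h.
  have : mu (\bigcup_n F n) = 0%E.
    apply: measure_negligible; first exact: bigcupT_measurable.
    apply: negligible_bigcup => n; apply/negligibleP => //.
    by apply: contrapT => /eqP Fn; apply: h; exists n.
  by rewrite cover probability_setT => -[] /eqP; rewrite oner_eq0.
pose S := [set c | mu (L c) = 0%E].
have S0 : S !=set0.
  have [n Ln] : exists n : nat, mu (~` L (- n%:R)) != 0%E.
    apply: (nonnull (fun n => ~` L (- n%:R))); first by move=> n; exact: measurableC.
    apply/seteqP; split=> // x _; exists (Num.bound (- f x)) => //=.
    apply/negP; rewrite -ltNge; have [f0|f0] := leP 0 (- f x).
      by rewrite ltrNl archi_boundP.
    by rewrite oppr_lt0 in f0; apply: le_lt_trans f0; rewrite oppr_le0.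
  exists (- n%:R); rewrite /S /=; have [//|L1] := zo (- n%:R).
  by move: Ln; rewrite probability_setC // [mu _]L1 subee // eqxx.
have [n1 Ln1] : exists n : nat, mu (L n%:R) != 0%E.
  apply: (nonnull (fun n => L n%:R)) => //.
  apply/seteqP; split=> // x _; exists (Num.bound `|f x|) => //.
  by rewrite /L /=; apply: le_trans (ler_norm _) (ltW _); rewrite archi_boundP.
have Sub c : mu (L c) != 0%E -> ubound S c.
  move=> Lc s Ss; rewrite leNgt; apply/negP => /ltW/LS; rewrite Ss => h.
  by move/negP: Lc; apply; rewrite eq_le h measure_ge0.
have hS : has_sup S by split=> //; exists n1%:R; exact: Sub.
exists (sup S).
have low : {ae mu, forall x, forall n : nat, ~ (f x <= sup S - n.+1%:R^-1)}.
  apply/ae_foralln => n; exists (L (sup S - n.+1%:R^-1)); split=> //; last first.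
    by move=> x /contrapT.
  have n0 : 0 < n.+1%:R^-1 :> R by rewrite invr_gt0.
  have [s Ss ss] := sup_adherent n0 hS.
  by apply/eqP; rewrite eq_le measure_ge0 andbT -Ss LS // ltW.
have up : {ae mu, forall x, forall n : nat, f x <= sup S + n.+1%:R^-1}.
  apply/ae_foralln => n; exists (~` L (sup S + n.+1%:R^-1)); split=> //.
    exact: measurableC.
  apply: L01; apply/negP => /eqP h; have := sup_upper_bound hS h.
  by rewrite gerDl leNgt invr_gt0 ltr0n.
apply: filterS2 low up => x lo hi; apply/eqP; rewrite eq_le; apply/andP; split.
  apply/ler_addgt0Pr => e e0; apply: le_trans (hi (Num.bound e^-1)) _.
  rewrite lerD2l invf_ple ?posrE // ltW //.
  by apply: lt_trans (archi_boundP _) _; rewrite ?invr_ge0 ?(ltW e0) // ltr_nat.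
apply/ler_addgt0Pr => e e0; rewrite -lerBlDr.
apply: le_trans (_ : sup S - (Num.bound e^-1).+1%:R^-1 <= _).
  rewrite lerD2l lerN2 invf_ple ?posrE // ltW //.
  by apply: lt_trans (archi_boundP _) _; rewrite ?invr_ge0 ?(ltW e0) // ltr_nat.
by rewrite ltW // ltNge; apply/negP.
Qed.

(** * Young partitions *)

Lemma settled_shape k (x : infinite_words k) : settled x ->
  forall m j, exists n0, forall n, (n0 <= n)%N -> forall i,
  word_levels (subword x j (m + n)) k.+1 i =
  (word_levels (subword x (j + m) n) k.+1 i +
   count (fun a : 'I_k.+1 => val a == i) (subword x j m))%N.
Proof.
move=> sx; elim=> [|m IH] j; first by exists 0%N => n _ i; rewrite addn0 /= addn0.
have [n0 h0] := IH j.+1; have [n1 h1] := settled_eventually j.+1 (x j) sx.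
exists (maxn n0 n1) => n; rewrite geq_max => /andP[n0n n1n] i.
rewrite addSn word_levels_subword h1; last exact: leq_trans n1n (leq_addl _ _).
by rewrite h0 // -addSnnS subwordS /= -addnA [i == _]eq_sym [(count _ _ + _)%N]addnC.
Qed.

Lemma settled_cycle_young_tail k M (x : infinite_words k) :
  settled x -> settled (cycle_coordinates M x) ->
  exists2 n, (1 <= n)%N & young_tail n (cycle_coordinates M x) x.
Proof.
move=> sx sy; have [n0 h0] := settled_shape sx M.+1 0.
have [n1 h1] := settled_shape sy M.+1 0.
exists (M.+1 + maxn n0 n1)%N; first by rewrite addSn.
move=> N nN; have hN : N = (M.+1 + (N - M.+1))%N by lia.
apply/eq_rsk_shape => i; rewrite hN.
rewrite -[initial_word x _]/(subword x 0 _)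
  -[initial_word _ _]/(subword (cycle_coordinates M x) 0 _).
rewrite h0 ?h1; [|lia|lia]; rewrite subword_cycle //; congr addn.
rewrite -[subword _ 0 _]/(initial_word _ M.+1) initial_word_cycle.
by apply/permP; rewrite perm_rot.
Qed.

(** The countable separating family consists of the events that the prefix of length [n] has the
    same value of [G] as [w], for [n] in [D]; [pickle] numbers the pairs [(n, w)]. *)
Lemma measurable_partition_words (R : realType)
  k (mu : probability (infinite_words k) R)
    (V : Type) (G : seq 'I_k.+1 -> V) (D : set nat) r :
  (forall x y, r x y <->
    forall n, D n -> G (initial_word x n) = G (initial_word y n)) ->
  measurable_partition mu r.
Proof.
move=> rE.
pose B i := [set x : infinite_words k |
  if unpickle i is Some (n, w) then D n /\ G (initial_word x n) = G w else False].
exists B; split.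
  move=> i; rewrite /B; case: (unpickle i : option (nat * seq 'I_k.+1)) => [[n w]|].
    exact: (measurable_subword 0 n [set v | D n /\ G v = G w]).
  by rewrite (_ : [set _ | _] = set0).
exists setT; first by split=> //; exact: probability_setT.
move=> x y _ _; rewrite rE; split=> [h i|h n Dn].
  rewrite /B /=; case: unpickle => // -[n w].
  by split=> -[Dn <-]; split=> //; rewrite h.
have := h (pickle (n, initial_word x n)); rewrite /B /= pickleK.
by case=> /(_ (conj Dn erefl)) [_ ->].
Qed.

Theorem theorem2 (R : realType) (k : nat) (p : 'I_k.+1 -> R)
    (p_sum : \sum_(i < k.+1) p i = 1)
    (p_noninc : forall i j : 'I_k.+1, (i <= j)%N -> p j <= p i)
    (p_last_gt0 : 0 < p ord_max)
    (mu : probability (infinite_words k) R) (mu_bernoulli : is_bernoulli p mu) :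
  (increasing_partitions mu (@young_cylinder k) /\
   total_partitions mu (@young_cylinder k)) /\
  (decreasing_partitions mu (@young_tail k) /\
   ergodic_partitions mu (@young_tail k)).
Proof.
have full := settled_full_measure p_sum p_noninc p_last_gt0 mu_bernoulli.
have fullT : full_measure mu setT by split=> //; exact: probability_setT.
split; split.
- move=> n _; split.
    apply: (@measurable_partition_words _ _ _ _ (@recording_tableau _) [set n]) => x y.
    by split=> [h _ ->|]; [exact: h|apply].
  exists setT => // x y _ _ h; rewrite /young_cylinder -!(take_initial_word _ (leqnSn
    n)).
  by apply: recording_take_inj h; rewrite size_mkseq.
- exists (@settled k) => // x y sx sy xy; apply: contrapT => h; apply: xy.
  apply: settled_separated => // n; apply: contrapT => ne; apply: h.
  exists n => N _ nN e; apply: ne; exact: (young_cylinder_levels nN e).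
- move=> n _; split; last by exists setT => // x y _ _ h N nN; apply: h; exact: ltnW.
  exact: (@measurable_partition_words _ _ _ _ (@rsk_shape _) [set N | (n <= N)%N]).
move=> f mf hf; apply: zero_one_ae_const => // c.
(* Since partitions are indexed from 1, [g n] is constant on the classes of the partition of index
   [n.+1]. *)
have [g hg] := choice (fun n => hf n.+1 isT).
have fg : {ae mu, forall x, forall n, f x = g n x}.
  by apply/ae_foralln => n; case: (hg n).
have inv M : {ae mu, forall x, f (cycle_coordinates M x) = f x}.
  have good : {ae mu, forall x, settled x /\ forall n, f x = g n x}.
    by apply: filterS2 (full_measure_ae full) fg.
  apply: filterS2 good (ae_cycle mu_bernoulli M good) => x [sx fx] [sy fy].
  (* The index from which the shapes agree depends on [x], hence the single set of full measure on
     which [f = g n] for all [n]. *)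
  have [[//|n] _ xy] := settled_cycle_young_tail sx sy.
  by rewrite (fx n) (fy n); have [_ h _] := hg n; exact: h.
apply: (exchangeable_zero_one mu_bernoulli).
  rewrite (_ : [set _ | _] = f @^-1` `]-oo, c]); last first.
    by apply/seteqP; split=> x; rewrite /= in_itv.
  by rewrite -[X in measurable X]setTI; exact: mf.
by move=> M; apply: filterS (inv M) => x /= ->.
Qed.
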